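(* Let $(X,\omega)$ be a paracompact boundaryless smooth effective symplectic orbifold (not necessarily compact, not necessarily a global quotient), let $\hbar>0$, and let $L\to X$ be a Hermitian orbifold line bundle. Then $L$ admits a unitary orbifold connection $\nabla$ whose curvature satisfies $$F_\nabla=-\frac{i}{\hbar}\,\omega$$ if and only if $$c_1^{\mathrm{dR}}(L)=\frac{1}{2\pi\hbar}[\omega]\quad\text{in } H^2_{\mathrm{dR,orb}}(X).$$
   Context: Orbifold: a paracompact Hausdorff space $|X|$ with an atlas of uniformizing charts $(V,G,\pi)$, where $V$ is a connected open subset of Euclidean space, $G$ is a finite group acting smoothly and effectively on $V$, and $\pi:V\to|X|$ is $G$-invariant and induces a homeomorphism from $V/G$ onto an open set; every point in the overlap of two charts lies in a smaller chart embedding into both, where an embedding is a smooth open embedding $V'\to V$ equivariant for an injective homomorphism $G'\to G$ and compatible with the projections. Orbifold forms are families of $G$-invariant forms on the charts compatible under chart embeddings; $H^*_{\mathrm{dR,orb}}(X)$ is the cohomology of the complex $\Omega^\bullet_{\mathrm{orb}}(X)$ of orbifold forms. A symplectic orbifold carries a closed nondegenerate orbifold 2-form $\omega$. A (Hermitian) orbifold line bundle is a family of $G$-equivariant (Hermitian) complex line bundles $L_V\to V$ glued by equivariant (unitary) isomorphisms over chart embeddings satisfying the cocycle condition. An orbifold connection is a compatible family of $G$-equivariant connections; it is unitary if it preserves the Hermitian metric. Its curvature $F_\nabla(Y,Z)=[\nabla_Y,\nabla_Z]-\nabla_{[Y,Z]}$ is an imaginary-valued closed orbifold 2-form. The de Rham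 first Chern class is $c_1^{\mathrm{dR}}(L)=\left[\frac{i}{2\pi}F_\nabla\right]\in H^2_{\mathrm{dR,orb}}(X)$ for any unitary orbifold connection $\nabla$ on $L$ (independent of the choice). *)

(* Defs.v *)
From HB Require Import structures.
From mathcomp Require Import all_boot all_order all_algebra all_fingroup.
From mathcomp Require Import all_classical all_reals all_analysis.
From mathcomp Require Import complex.

Set Implicit Arguments.
Unset Strict Implicit.
Unset Printing Implicit Defensive.

Import Order.TTheory GRing.Theory Num.Theory.
Import numFieldNormedType.Exports.

Local Open Scope classical_set_scope.
Local Open Scope ring_scope.
Local Open Scope complex_scope.

(** ** Smooth maps on open subsets of Euclidean space *)

Section Smooth.
Context {R : realType}.

Fixpoint iter_derive n (W : normedModType R) (vs : seq 'rV[R]_n)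
    (f : 'rV[R]_n -> W) : 'rV[R]_n -> W :=
  if vs is v :: vs' then 'D_v (iter_derive vs' f) else f.

(* C^oo on an open set [U]: all iterated directional derivatives, of all
   orders, exist and are continuous on [U]. *)
Definition smooth_on n (W : normedModType R) (U : set 'rV[R]_n)
    (f : 'rV[R]_n -> W) : Prop :=
  forall vs x, U x ->
    {for x, continuous (iter_derive vs f)} /\
    (forall v, derivable (iter_derive vs f) x v).

Definition smoothC_on n (U : set 'rV[R]_n) (f : 'rV[R]_n -> R[i]) : Prop :=
  smooth_on U (fun x => complex.Re (f x) : R^o) /\
  smooth_on U (fun x => complex.Im (f x) : R^o).

Definition deriveC n (f : 'rV[R]_n -> R[i]) (y x : 'rV[R]_n) : R[i] :=
  ('D_y (fun z => complex.Re (f z) : R^o) x)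
    +i* ('D_y (fun z => complex.Im (f z) : R^o) x).

Definition lie_bracket n (Y Z : 'rV[R]_n -> 'rV[R]_n) (x : 'rV[R]_n) :
  'rV[R]_n := 'D_(Y x) Z x - 'D_(Z x) Y x.

(* Diffeomorphism onto an open subset of [V']. *)
Definition smooth_open_embedding m n (V : set 'rV[R]_m) (V' : set 'rV[R]_n)
    (f : 'rV[R]_m -> 'rV[R]_n) : Prop :=
  [/\ smooth_on V f, f @` V `<=` V', open (f @` V) &
      exists2 h : 'rV[R]_n -> 'rV[R]_m,
        smooth_on (f @` V) h & {in V, cancel f h}].

End Smooth.

(** ** Effective orbifolds *)

Definition locally_finite (T : topologicalType) (F : set (set T)) : Prop :=
  forall x : T, exists2 N, nbhs x N &
    finite_set [set B | F B /\ B `&` N !=set0].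

Definition paracompact (T : topologicalType) : Prop :=
  forall F : set (set T), F `<=` open -> \bigcup_(A in F) A = [set: T] ->
  exists F' : set (set T),
    [/\ F' `<=` open, \bigcup_(B in F') B = [set: T], locally_finite F' &
        forall B, F' B -> exists2 A, F A & B `<=` A].

(* A uniformizing chart.  The maps [cact] and [cproj] are total but only
   matter on [cdom]; [cact] is a left action.  Different charts are allowed to
   have different dimensions. *)
Record chart (R : realType) (T : topologicalType) := Chart {
  cdim : nat;
  cdom : set 'rV[R]_cdim;
  cgrp : finGroupType;
  cact : cgrp -> 'rV[R]_cdim -> 'rV[R]_cdim;
  cproj : 'rV[R]_cdim -> T;
  cdom_open : open cdom;
  cdom_connected : connected cdom;
  cact_dom : forall g x, cdom x -> cdom (cact g x);
  cact1 : forall x, cdom x -> cact 1%g x = x;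
  cactM : forall g h x, cdom x -> cact (g * h)%g x = cact g (cact h x);
  cact_smooth : forall g, smooth_on cdom (cact g);
  cact_effective : forall g, (forall x, cdom x -> cact g x = x) -> g = 1%g;
  (* [cproj] induces a bijection from the orbit space of [cdom] onto its image,
     which is a homeomorphism for the quotient topology. *)
  cproj_orbit : forall x y, cdom x -> cdom y ->
    (cproj x = cproj y <-> exists g, y = cact g x);
  cproj_open : open (cproj @` cdom);
  cproj_homeo : forall W : set T, W `<=` cproj @` cdom ->
    (open W <-> open (cdom `&` cproj @^-1` W)) }.

Arguments cdom {R T} c _.
Arguments cproj {R T} c _.

Record chart_embedding (R : realType) (T : topologicalType)
    (c c' : chart R T) := ChartEmbedding {
  emap :> 'rV[R]_(cdim c) -> 'rV[R]_(cdim c');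
  ehom : cgrp c -> cgrp c';
  emap_embedding : smooth_open_embedding (cdom c) (cdom c') emap;
  ehom_morph : {morph ehom : g h / (g * h)%g};
  ehom_inj : injective ehom;
  emap_equivariant : forall g x, cdom c x ->
    emap (cact g x) = cact (ehom g) (emap x);
  emap_proj : forall x, cdom c x -> cproj c' (emap x) = cproj c x }.

Record orbifold (R : realType) := Orbifold {
  ospace :> topologicalType;
  oidx : Type;
  ochart : oidx -> chart R ospace;
  ospace_hausdorff : hausdorff_space ospace;
  ospace_paracompact : paracompact ospace;
  ochart_cover : forall p : ospace,
    exists i, (cproj (ochart i) @` cdom (ochart i)) p;
  ochart_compatible : forall (i j : oidx) (p : ospace),
    (cproj (ochart i) @` cdom (ochart i)) p ->
    (cproj (ochart j) @` cdom (ochart j)) p ->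
    exists k : oidx,
      [/\ (cproj (ochart k) @` cdom (ochart k)) p,
          inhabited (chart_embedding (ochart k) (ochart i)) &
          inhabited (chart_embedding (ochart k) (ochart j))] }.

Definition odim (R : realType) (X : orbifold R) (i : oidx X) : nat :=
  cdim (ochart i).
Definition odom (R : realType) (X : orbifold R) (i : oidx X) :
  set 'rV[R]_(odim i) := cdom (ochart i).
Arguments odom {R X} i _.

(** ** Orbifold differential forms *)

(* The arguments of a [k]-form are the rows of a matrix with [k] rows. *)
Definition rawform (R : realType) (k n : nat) : Type :=
  'rV[R]_n -> 'M[R]_(k, n) -> R.

Section Forms.
Context {R : realType}.

Definition multilinear_alternating k n (f : 'M[R]_(k, n) -> R) : Prop :=
  (forall (A B C : 'M[R]_(k, n)) (a : 'I_k) (b c : R),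
      row a A = b *: row a B + c *: row a C ->
      row' a B = row' a A -> row' a C = row' a A ->
      f A = b * f B + c * f C) /\
  (forall (A : 'M[R]_(k, n)) (a b : 'I_k), a != b -> row a A = row b A ->
      f A = 0).

Definition is_form k n (V : set 'rV[R]_n) (eta : rawform R k n) : Prop :=
  (forall x, V x -> multilinear_alternating (eta x)) /\
  (forall v, smooth_on V (fun x => eta x v : R^o)).

(* Evaluation of the exterior derivative on constant vector fields. *)
Definition dform k n (eta : rawform R k n) : rawform R k.+1 n :=
  fun x v => \sum_(a < k.+1)
    (-1) ^+ a * 'D_(row a v) (fun z => eta z (row' a v) : R^o) x.

Definition pullback k m n (f : 'rV[R]_m -> 'rV[R]_n) (eta : rawform R k n) :
  rawform R k m := fun x v => eta (f x) (\matrix_(a < k) 'D_(row a v) f x).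

End Forms.

Record oform (R : realType) (X : orbifold R) (k : nat) := OForm {
  ofam :> forall i : oidx X, rawform R k (odim i);
  ofam_form : forall i, is_form (odom i) (@ofam i);
  ofam_invariant : forall i (g : cgrp (ochart i)) x v, odom i x ->
    pullback (cact g) (@ofam i) x v = @ofam i x v;
  ofam_compatible : forall i j (e : chart_embedding (ochart i) (ochart j)) x v,
    odom i x -> pullback e (@ofam j) x v = @ofam i x v }.
Arguments ofam {R X k} o i _ _.

Section DeRham.
Context {R : realType} (X : orbifold R).

Definition oclosed k (eta : oform X k) : Prop :=
  forall i x v, odom i x -> dform (eta i) x v = 0.

(* The class in the de Rham cohomology of orbifold forms, in degree [k.+1], of
   the closed orbifold form given on the charts by [eta], as the set of closed
   orbifold forms differing from it by an exact orbifold form. *)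
Definition dR_class k (eta : forall i : oidx X, rawform R k.+1 (odim i)) :
    set (oform X k.+1) :=
  [set theta : oform X k.+1 | oclosed theta /\
    exists alpha : oform X k, forall i x v, odom i x ->
      theta i x v = eta i x v + dform (alpha i) x v].

Definition symplectic (omega : oform X 2) : Prop :=
  oclosed omega /\
  forall i x, odom i x -> forall y : 'rV[R]_(odim i), y != 0 ->
    exists z : 'rV[R]_(odim i), omega i x (col_mx y z) != 0.

End DeRham.

(** ** Complex line bundles and connections on an open subset of R^n *)

(* [ltriv a] is a trivialization over [ldom a] (junk outside of it), and the
   change of trivializations is by smooth functions. *)
Record line_bundle (R : realType) (n : nat) (V : set 'rV[R]_n) := LineBundle {
  lfib :> 'rV[R]_n -> lmodType R[i];
  lidx : Type;
  ldom : lidx -> set 'rV[R]_n;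
  ltriv : lidx -> forall x, {linear lfib x -> R[i]^o};
  ldom_open : forall a, open (ldom a);
  ldom_cover : \bigcup_a ldom a = V;
  ltriv_bij : forall a x, ldom a x -> bijective (ltriv a x);
  ltriv_change : forall a b, exists2 u : 'rV[R]_n -> R[i],
    smoothC_on (ldom a `&` ldom b) u &
    forall x, ldom a x -> ldom b x -> forall v : lfib x,
      ltriv b x v = u x * ltriv a x v }.

Arguments ldom {R n V} l _ _.

(* A point of the total space. *)
Definition ltot (R : realType) n (V : set 'rV[R]_n) (L : line_bundle V) x
    (v : L x) : {x : 'rV[R]_n & L x} := Tagged (fun x => L x : Type) v.

Section LineBundles.
Context {R : realType}.

Definition smooth_section n (V : set 'rV[R]_n) (L : line_bundle V)
    (U : set 'rV[R]_n) (s : forall x, L x) : Prop :=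
  forall a, smoothC_on (U `&` ldom L a) (fun x => ltriv a x (s x)).

(* Smooth isomorphism of line bundles [L -> L'] over the smooth map [f]. *)
Definition bundle_iso m n (V : set 'rV[R]_m) (V' : set 'rV[R]_n)
    (L : line_bundle V) (L' : line_bundle V') (f : 'rV[R]_m -> 'rV[R]_n)
    (phi : forall x, L x -> L' (f x)) : Prop :=
  (forall x, V x -> linear (phi x) /\ bijective (phi x)) /\
  (forall a b, exists2 u : 'rV[R]_m -> R[i],
    smoothC_on (ldom L a `&` f @^-1` (ldom L' b)) u &
    forall x, ldom L a x -> ldom L' b (f x) -> forall v : L x,
      ltriv b (f x) (phi x v) = u x * ltriv a x v).

(* Hermitian metrics are linear in their first argument. *)
Record hermitian_metric n (V : set 'rV[R]_n) (L : line_bundle V) := Hermitian {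
  hdot :> forall x, L x -> L x -> R[i];
  hdot_linear : forall x, V x -> forall w, scalar (fun v : L x => hdot v w);
  hdot_sym : forall x, V x -> forall v w : L x, hdot v w = ((hdot w v)^*)%C;
  hdot_gt0 : forall x, V x -> forall v : L x, v != 0 -> 0 < hdot v v;
  hdot_smooth : forall (U : set 'rV[R]_n) (s t : forall x, L x),
    open U -> U `<=` V -> smooth_section U s -> smooth_section U t ->
    smoothC_on U (fun x => hdot (s x) (t x)) }.

(* [nabla y s x] is the derivative at [x], in the direction [y], of the section
   [s], which only needs to be smooth in a neighbourhood of [x]. *)
Record connection n (V : set 'rV[R]_n) (L : line_bundle V) := Connection {
  nabla :> 'rV[R]_n -> (forall x, L x) -> forall x, L x;
  nabla_local : forall (U : set 'rV[R]_n) (s t : forall x, L x),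
    open U -> U `<=` V -> smooth_section U s -> smooth_section U t ->
    (forall x, U x -> s x = t x) ->
    forall y x, U x -> nabla y s x = nabla y t x;
  nabla_smooth : forall (U : set 'rV[R]_n) (s : forall x, L x) y,
    open U -> U `<=` V -> smooth_section U s -> smooth_section U (nabla y s);
  nabla_dir : forall (U : set 'rV[R]_n) (s : forall x, L x),
    open U -> U `<=` V -> smooth_section U s ->
    forall (r : R) y z x, U x ->
    nabla (r *: y + z) s x = r%:C *: nabla y s x + nabla z s x;
  nablaD : forall (U : set 'rV[R]_n) (s t : forall x, L x),
    open U -> U `<=` V -> smooth_section U s -> smooth_section U t ->
    forall y x, U x ->
    nabla y (fun z => s z + t z) x = nabla y s x + nabla y t x;
  nabla_leibniz : forall (U : set 'rV[R]_n) (f : 'rV[R]_n -> R[i])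
      (s : forall x, L x),
    open U -> U `<=` V -> smoothC_on U f -> smooth_section U s ->
    forall y x, U x ->
    nabla y (fun z => f z *: s z) x = deriveC f y x *: s x + f x *: nabla y s x }.

Definition unitary n (V : set 'rV[R]_n) (L : line_bundle V) (h : hermitian_metric L)
    (D : connection L) : Prop :=
  forall (U : set 'rV[R]_n) (s t : forall x, L x),
    open U -> U `<=` V -> smooth_section U s -> smooth_section U t ->
    forall y x, U x ->
    deriveC (fun z => h z (s z) (t z)) y x =
      h x (D y s x) (t x) + h x (s x) (D y t x).

(* The bundle isomorphism [phi] over the open embedding [f] maps [D] to [D']. *)
Definition intertwines m n (V : set 'rV[R]_m) (V' : set 'rV[R]_n)
    (L : line_bundle V) (L' : line_bundle V') (f : 'rV[R]_m -> 'rV[R]_n)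
    (phi : forall x, L x -> L' (f x)) (D : connection L) (D' : connection L') :
    Prop :=
  forall (U : set 'rV[R]_m) (U' : set 'rV[R]_n)
      (s : forall x, L x) (s' : forall x, L' x),
    open U -> U `<=` V -> open U' -> U' `<=` V' -> f @` U `<=` U' ->
    smooth_section U s -> smooth_section U' s' ->
    (forall x, U x -> phi x (s x) = s' (f x)) ->
    forall y x, U x -> phi x (D y s x) = D' ('D_y f x) s' (f x).

(* ([\nabla_Y, \nabla_Z] - \nabla_[Y,Z]) s *)
Definition curvature_op n (V : set 'rV[R]_n) (L : line_bundle V)
    (D : connection L) (Y Z : 'rV[R]_n -> 'rV[R]_n) (s : forall x, L x)
    (x : 'rV[R]_n) : L x :=
  D (Y x) (fun z => D (Z z) s z) x - D (Z x) (fun z => D (Y z) s z) x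
  - D (lie_bracket Y Z x) s x.

(* The curvature at [x] on the two rows [v] is the scalar by which the
   operator above acts at [x], for any local vector fields extending the rows of
   [v] and any local section. *)
Definition curvature n (V : set 'rV[R]_n) (L : line_bundle V)
    (D : connection L) (x : 'rV[R]_n) (v : 'M[R]_(2, n)) : R[i] :=
  xget 0 [set c : R[i] |
    forall (U : set 'rV[R]_n) (Y Z : 'rV[R]_n -> 'rV[R]_n) (s : forall x, L x),
    open U -> U `<=` V -> U x ->
    smooth_on U Y -> smooth_on U Z -> smooth_section U s ->
    Y x = row 0 v -> Z x = row 1 v ->
    curvature_op D Y Z s x = c *: s x].

End LineBundles.

(** ** Hermitian orbifold line bundles *)

(* Vectors are compared as points of the total spaces because base points are
   only propositionally equal.  A gluing map could a priori depend on the values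
   of the embedding outside of the chart domain, but [oglue_cocycle] rules this
   out. *)
Record herm_orbi_line_bundle (R : realType) (X : orbifold R) :=
    HermOrbiLineBundle {
  obun : forall i : oidx X, line_bundle (odom i);
  oherm : forall i, hermitian_metric (obun i);
  oact : forall i (g : cgrp (ochart i)) x, obun i x -> obun i (cact g x);
  oact_iso : forall i g, bundle_iso (@oact i g);
  oact1 : forall i x (v : obun i x), odom i x ->
    ltot (oact 1%g v) = ltot v;
  oactM : forall i g h x (v : obun i x), odom i x ->
    ltot (oact (g * h)%g v) = ltot (oact g (oact h v));
  oact_unitary : forall i g x (v w : obun i x), odom i x ->
    oherm i _ (oact g v) (oact g w) = oherm i x v w;
  oglue : forall i j (e : chart_embedding (ochart i) (ochart j)) x,
    obun i x -> obun j (e x);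
  oglue_iso : forall i j e, bundle_iso (@oglue i j e);
  oglue_unitary : forall i j e x (v w : obun i x), odom i x ->
    oherm j _ (oglue e v) (oglue e w) = oherm i x v w;
  oglue_equivariant : forall i j (e : chart_embedding (ochart i) (ochart j))
      g x (v : obun i x), odom i x ->
    ltot (oglue e (oact g v)) =
    ltot (oact (ehom e g) (oglue e v));
  oglue_cocycle : forall i j k (e : chart_embedding (ochart i) (ochart j))
      (e' : chart_embedding (ochart j) (ochart k))
      (e'' : chart_embedding (ochart i) (ochart k)),
    (forall x, odom i x -> e'' x = e' (e x)) ->
    forall x (v : obun i x), odom i x ->
    ltot (oglue e'' v) = ltot (oglue e' (oglue e v));
  (* An element of the group of a chart is an embedding of this chart into
     itself; gluing along it is the group action. *)
  oglue_act : forall i (e : chart_embedding (ochart i) (ochart i)) g,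
    (forall x, odom i x -> e x = cact g x) ->
    forall x (v : obun i x), odom i x ->
    ltot (oglue e v) = ltot (oact g v) }.

Record orbi_connection (R : realType) (X : orbifold R)
    (L : herm_orbi_line_bundle X) := OrbiConnection {
  oconn :> forall i, connection (obun L i);
  oconn_equivariant : forall i g,
    intertwines (@oact R X L i g) (oconn i) (oconn i);
  oconn_compatible : forall i j e,
    intertwines (@oglue R X L i j e) (oconn i) (oconn j) }.

Section ChernClass.
Context {R : realType} {X : orbifold R} (L : herm_orbi_line_bundle X).

Definition ounitary (D : orbi_connection L) : Prop :=
  forall i, unitary (oherm L i) (D i).

(* The curvature of a unitary connection is imaginary-valued, so that taking the
   real part merely turns a real-valued complex form into a real form. *)
Definition chern_form (D : orbi_connection L) (i : oidx X) :
    rawform R 2 (odim i) :=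
  fun x v => complex.Re ('i%C / (2 * pi)%:C * curvature (D i) x v).

(* The class of [i/(2 pi) F] for any unitary orbifold connection. *)
Definition c1dR : set (oform X 2) :=
  xget set0 [set c | exists2 D : orbi_connection L, ounitary D &
                     c = dR_class (chern_form D)].

End ChernClass.

(* Main.v *)
(* The difference of two unitary orbifold connections is an imaginary orbifold
   1-form [A], and the curvature of [D + A] is [F_D + dA].  Rescaling [A] by
   [i / 2 pi] makes it real, so the Chern forms of unitary connections differ by
   exact orbifold forms: this gives the direct implication.  Conversely, if
   [omega / (2 pi hbar)] is the Chern form of [D] plus [d alpha], then the
   connection [D - 2 pi i alpha] has the prescribed curvature.  No partition of
   unity is needed: [c1dR L] is empty when [L] has no unitary connection, while
   the right-hand class contains [omega / (2 pi hbar)]. *)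

Require Import Defs.
From mathcomp Require Import all_boot all_order all_algebra.
From mathcomp Require Import all_classical all_reals all_analysis.
From mathcomp Require Import complex ring.

Set Implicit Arguments.
Unset Strict Implicit.
Unset Printing Implicit Defensive.

Import Order.TTheory GRing.Theory Num.Theory.
Import numFieldNormedType.Exports.

Local Open Scope classical_set_scope.
Local Open Scope ring_scope.
Local Open Scope complex_scope.

(** * Calculus of smooth functions *)

(** A connection is given here as an operator on sections, without connection forms, and [curvature]
    is a choice with default value 0. The formula for the curvature of $D+A$ therefore rests on one
    principle: an operator that depends on a section only near $x$ and is linear over functions acts
    at $x$ by a scalar, which a local frame detects. This principle yields the form $D'-D$ without
    gluing over trivializations, and the curvature itself once second derivatives are known to
    commute; that symmetry is derived from the mean value theorem, smoothness being stated through
    iterated directional derivatives. Scalars commute, so $A \wedge A$ never appears. Descent to the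
    orbifold is a single computation, because group elements and gluing maps are both bundle
    isomorphisms over smooth maps. Orbifold forms are real, so an imaginary 1-form is carried as a
    complex constant times a real form. *)

Section SmoothFunctions.
Context {R : realType} {n : nat}.
Implicit Types (U : set 'rV[R]_n) (v x : 'rV[R]_n).

Lemma near_open_eq (W : Type) U (f g : 'rV[R]_n -> W) x :
  open U -> (forall z, U z -> f z = g z) -> U x -> \near x, f x = g x.
Proof. by move=> oU fg Ux; apply: filterS fg _; exact: open_nbhs_nbhs. Qed.

Lemma derive_eq_on (W : normedModType R) U (f g : 'rV[R]_n -> W) x v :
  open U -> (forall z, U z -> f z = g z) -> U x -> 'D_v f x = 'D_v g x.
Proof.
(* The zero direction is split off because [near_eq_derive] asks for a nonzero one. *)
move=> oU fg Ux; have [->|v0] := eqVneq v 0; first by rewrite !derive0.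
exact: near_eq_derive (near_open_eq oU fg Ux).
Qed.

Lemma derivable_eq_on (W : normedModType R) U (f g : 'rV[R]_n -> W) x v :
  open U -> (forall z, U z -> f z = g z) -> U x ->
  derivable f x v -> derivable g x v.
Proof.
move=> oU fg Ux; have [->|v0] := eqVneq v 0;
  first by move=> _; exact: derivable0.
exact: near_eq_derivable (near_open_eq oU fg Ux).
Qed.

Lemma continuous_eq_on (W : topologicalType) U (f g : 'rV[R]_n -> W) x :
  open U -> (forall z, U z -> f z = g z) -> U x ->
  {for x, continuous f} -> {for x, continuous g}.
Proof.
move=> oU fg Ux; rewrite /prop_for /continuous_at -(fg _ Ux).
apply: cvg_trans; apply: near_eq_cvg;
  [exact: (nbhs_filter x)|exact: near_open_eq oU fg Ux].
Qed.

Section Normed.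
Context {W : normedModType R}.
Implicit Types f g : 'rV[R]_n -> W.

Lemma iter_derive_rcons vs v f :
  iter_derive (rcons vs v) f = iter_derive vs ('D_v f).
Proof. by elim: vs => //= w vs ->. Qed.

Lemma smooth_cont U f x : smooth_on U f -> U x -> {for x, continuous f}.
Proof. by move=> /(_ [::] x) + Ux => /(_ Ux)[]. Qed.

Lemma smooth_derivable U f x v : smooth_on U f -> U x -> derivable f x v.
Proof. by move=> /(_ [::] x) + Ux => /(_ Ux)[_]; exact. Qed.

Lemma smooth_derive U f v : smooth_on U f -> smooth_on U ('D_v f).
Proof. by move=> sf vs x Ux; rewrite -iter_derive_rcons; exact: sf. Qed.

(** The last direction of the list is differentiated first, and this derivative stays in [P]:
    induction on the list from its end reduces every order to order zero. Smoothness thus follows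
    from an invariant class, with no formula for higher derivatives. *)
Lemma smooth_coind U (P : ('rV[R]_n -> W) -> Prop) :
  (forall f, P f -> forall x, U x ->
    {for x, continuous f} /\ (forall v, derivable f x v)) ->
  (forall f v, P f -> P ('D_v f)) ->
  forall f, P f -> smooth_on U f.
Proof.
move=> Pcd Pd f Pf vs; elim/last_ind: vs f Pf => [|vs v IH] f Pf x Ux.
  exact: Pcd.
by rewrite iter_derive_rcons; apply: IH => //; exact: Pd.
Qed.

Lemma smooth_sub U U' f : U' `<=` U -> smooth_on U f -> smooth_on U' f.
Proof. by move=> sU sf vs x /sU; exact: sf. Qed.

Lemma smooth_local U f :
  (forall x, U x -> exists2 U', U' x & smooth_on U' f) -> smooth_on U f.
Proof. by move=> lf vs x /lf[U' Ux sf]; exact: sf. Qed.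

Lemma smooth_eq_on U f g : open U -> (forall z, U z -> f z = g z) ->
  smooth_on U f -> smooth_on U g.
Proof.
move=> oU fg sf.
apply: (@smooth_coind U (fun g => exists2 f, smooth_on U f &
   forall z, U z -> f z = g z)); last by exists f.
- move=> {}g [{}f {}sf {}fg] x Ux; split.
    by apply: continuous_eq_on oU fg Ux (smooth_cont sf Ux).
  by move=> v; apply: derivable_eq_on oU fg Ux (smooth_derivable sf Ux).
- move=> {}g v [{}f {}sf {}fg]; exists ('D_v f); first exact: smooth_derive.
  by move=> z; exact: derive_eq_on.
Qed.

Lemma smooth_cst U (w : W) : smooth_on U (fun=> w).
Proof.
apply: (@smooth_coind U (fun f => exists w, f = cst w)); last by exists w.
- move=> _ [{}w ->] x _; split; first exact: cst_continuous.
  by move=> v; exact: derivable_cst.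
- by move=> _ v [{}w ->]; exists 0; apply/funext => x; rewrite derive_cst.
Qed.

End Normed.

(* Up to equality on [U], this class of functions is stable under directional
   derivatives, which gives the smoothness of sums, products and inverses by one
   coinduction. *)
Inductive smooth_alg U : ('rV[R]_n -> R^o) -> Prop :=
| SmoothAtom f : smooth_on U f -> smooth_alg U f
| SmoothAdd f g : smooth_alg U f -> smooth_alg U g -> smooth_alg U (f + g)
| SmoothMul f g : smooth_alg U f -> smooth_alg U g -> smooth_alg U (f * g)
| SmoothInv f : (forall x, U x -> f x != 0) -> smooth_alg U f ->
    smooth_alg U (fun x => (f x)^-1)
| SmoothEq f g : (forall x, U x -> f x = g x) -> smooth_alg U f ->
    smooth_alg U g.

Lemma smooth_alg_smooth U f : open U -> smooth_alg U f -> smooth_on U f.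
Proof.
move=> oU; move: f.
have cd f : smooth_alg U f -> forall x, U x ->
    {for x, continuous f} /\ (forall v, derivable f x v).
  elim=> {f} [f sf|f g _ IHf _ IHg|f g _ IHf _ IHg|f f0 _ IHf
             |f g fg _ IHf] x Ux.
  - split; first exact: smooth_cont sf Ux.
    by move=> v; exact: smooth_derivable sf Ux.
  - have [cf df] := IHf _ Ux; have [cg dg] := IHg _ Ux.
    by split; [exact: continuousD|move=> v; exact: derivableD].
  - have [cf df] := IHf _ Ux; have [cg dg] := IHg _ Ux.
    by split; [exact: continuousM|move=> v; exact: derivableM].
  - have [cf df] := IHf _ Ux.
    split; first by apply: continuousV => //; exact: f0.
    by move=> v; apply: derivableV => //; exact: f0.
  - have [cf df] := IHf _ Ux.
    split; first exact: continuous_eq_on oU fg Ux cf.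
    by move=> v; exact: derivable_eq_on oU fg Ux (df v).
apply: smooth_coind => //.
move=> f v; elim=> {f} [f sf|f g Af IHf Ag IHg|f g Af IHf Ag IHg|f f0 Af IHf
                      |f g fg Af IHf].
- exact/SmoothAtom/smooth_derive.
- apply: (@SmoothEq _ ('D_v f + 'D_v g)); last exact: SmoothAdd.
  by move=> x Ux; rewrite deriveD //;
    [exact: (cd _ Af _ Ux).2|exact: (cd _ Ag _ Ux).2].
- apply: (@SmoothEq _ (f * 'D_v g + g * 'D_v f)).
    by move=> x Ux; rewrite deriveM //;
      [exact: (cd _ Af _ Ux).2|exact: (cd _ Ag _ Ux).2].
  by apply: SmoothAdd; apply: SmoothMul.
(* This is $-f^{-2} D_v f$, with the sign as a constant atom so that only constructors of the class
   occur. *)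
- apply: (@SmoothEq _ ((fun=> -1) * ((fun x => (f x)^-1) * (fun x => (f x)^-1))
  * 'D_v f)).
    move=> x Ux; rewrite deriveV //; [|exact: f0|exact: (cd _ Af _ Ux).2].
    by rewrite !fctE mulN1r -expr2 exprVn.
  apply: SmoothMul => //; apply: SmoothMul; first exact/SmoothAtom/smooth_cst.
  by apply: SmoothMul; apply: SmoothInv.
- apply: (@SmoothEq _ ('D_v f)) => // x; exact: derive_eq_on.
Qed.

(* The statements below use the operations of [R] rather than those of [R^o]:
   identifying the two by unification is costly. *)
Section RealValued.
Implicit Types f g : 'rV[R]_n -> R.

Lemma smoothD U f g : open U ->
  smooth_on U (f : _ -> R^o) -> smooth_on U (g : _ -> R^o) ->
  smooth_on U (fun x => f x + g x : R^o).
Proof. by move=> oU sf sg; apply: (smooth_alg_smooth oU);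
  exact: SmoothAdd (SmoothAtom sf) (SmoothAtom sg). Qed.

Lemma smoothM U f g : open U ->
  smooth_on U (f : _ -> R^o) -> smooth_on U (g : _ -> R^o) ->
  smooth_on U (fun x => f x * g x : R^o).
Proof. by move=> oU sf sg; apply: (smooth_alg_smooth oU);
  exact: SmoothMul (SmoothAtom sf) (SmoothAtom sg). Qed.

Lemma smoothV U f : open U -> (forall x, U x -> f x != 0) ->
  smooth_on U (f : _ -> R^o) -> smooth_on U (fun x => (f x)^-1 : R^o).
Proof. by move=> oU f0 sf; apply: (smooth_alg_smooth oU);
  exact: SmoothInv f0 (SmoothAtom sf). Qed.

Lemma smoothN U f : open U ->
  smooth_on U (f : _ -> R^o) -> smooth_on U (fun x => - f x : R^o).
Proof.
move=> oU sf.
have := @smoothM U (fun=> -1) f oU (smooth_cst (-1 : R^o)) sf.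
by apply: smooth_eq_on => // x _; exact: mulN1r.
Qed.

Lemma smoothB U f g : open U ->
  smooth_on U (f : _ -> R^o) -> smooth_on U (g : _ -> R^o) ->
  smooth_on U (fun x => f x - g x : R^o).
Proof. by move=> oU sf sg; exact: smoothD oU sf (smoothN oU sg). Qed.

Lemma deriveRD f g x v :
  derivable (f : _ -> R^o) x v -> derivable (g : _ -> R^o) x v ->
  'D_v (fun z => f z + g z : R^o) x =
    'D_v (f : _ -> R^o) x + 'D_v (g : _ -> R^o) x :> R.
Proof. exact: deriveD. Qed.

Lemma deriveRN f x v : derivable (f : _ -> R^o) x v ->
  'D_v (fun z => - f z : R^o) x = - 'D_v (f : _ -> R^o) x :> R.
Proof. exact: deriveN. Qed.

Lemma deriveRB f g x v :
  derivable (f : _ -> R^o) x v -> derivable (g : _ -> R^o) x v ->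
  'D_v (fun z => f z - g z : R^o) x =
    'D_v (f : _ -> R^o) x - 'D_v (g : _ -> R^o) x :> R.
Proof. exact: deriveB. Qed.

Lemma deriveRM f g x v :
  derivable (f : _ -> R^o) x v -> derivable (g : _ -> R^o) x v ->
  'D_v (fun z => f z * g z : R^o) x =
    f x * 'D_v (g : _ -> R^o) x + g x * 'D_v (f : _ -> R^o) x :> R.
Proof. exact: deriveM. Qed.

Lemma derivableRM f g x v :
  derivable (f : _ -> R^o) x v -> derivable (g : _ -> R^o) x v ->
  derivable (fun z => f z * g z : R^o) x v.
Proof. exact: derivableM. Qed.

End RealValued.

End SmoothFunctions.

(** * Symmetry of second derivatives *)

Section Schwarz.
Context {R : realType} {n : nat}.
Implicit Types (U : set 'rV[R]_n) (u v x : 'rV[R]_n) (f : 'rV[R]_n -> R^o).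

(** Restriction to a line makes the one-variable mean value theorem available. *)
Lemma is_derive_line f x u (s : R) : derivable f (x + s *: u) u ->
  is_derive s 1 (fun t : R => f (x + t *: u) : R^o) ('D_u f (x + s *: u)).
Proof.
have e : (fun h : R => h^-1 *: (((fun t : R => f (x + t *: u) : R^o)
        \o shift s) (h *: 1) - f (x + s *: u))) =
    (fun h => h^-1 *: ((f \o shift (x + s *: u)) (h *: u) - f (x + s *: u))).
  apply/funext => h /=; congr (_ *: (f _ - _)).
  by rewrite [h *: 1]mulr1 scalerDl addrCA addrA.
by move=> df; split; [move: df; rewrite /derivable e|rewrite /derive e].
Qed.

Lemma is_derive_continuous_itv (f df : R -> R^o) (a b : R) :
  (forall s, a <= s <= b -> is_derive s 1 f (df s)) ->
  {within `[a, b], continuous f}.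
Proof.
move=> dfs; apply: continuous_in_subspaceT => s;
  rewrite inE /= in_itv /= => sab.
by apply: differentiable_continuous; apply/derivable1_diffP;
  have [] := dfs _ sab.
Qed.

(** What two applications of the mean value theorem give when [g] is a mixed second derivative of
    [f]. It is stated for any [g] because the comparison of the two orders of derivation then uses
    only continuity. *)
Definition mixed_difference U f g x u v := forall h : R, 0 < h ->
  (forall s t, 0 <= s <= h -> 0 <= t <= h -> U (x + s *: u + t *: v)) ->
  exists s t, [/\ 0 <= s <= h, 0 <= t <= h &
    f (x + h *: u + h *: v) - f (x + h *: u) - f (x + h *: v) + f x =
    g (x + s *: u + t *: v) * h * h].

(** The mean value theorem is applied to $s \mapsto f(x+hv+su)-f(x+su)$, then, at the point $s$ so
    found, to $t \mapsto D_uf(x+su+tv)$. *)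
Lemma mixed_difference_derive U f x u v : smooth_on U f ->
  mixed_difference U f ('D_v ('D_u f)) x u v.
Proof.
move=> sf h h0 Uh; have hh : 0 <= h <= h by rewrite ltW //=.
have h00 : 0 <= (0 : R) <= h by rewrite lexx ltW.
pose dphi s : R^o := 'D_u f (x + h *: v + s *: u) - 'D_u f (x + s *: u).
have dphiP s : 0 <= s <= h ->
    is_derive s 1 (fun t : R => f (x + h *: v + t *: u) - f (x + t *: u) : R^o)
      (dphi s).
  move=> sh; apply: is_deriveB; apply: is_derive_line.
    by apply: smooth_derivable sf _; rewrite addrAC; exact: Uh.
  by apply: smooth_derivable sf _; have := Uh s 0 sh h00; rewrite scale0r addr0.
have [s] := MVT h0
  (fun s (sh : s \in `]0, h[%R) => dphiP s (subset_itv_oo_cc sh))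
  (is_derive_continuous_itv dphiP).
move=> /subset_itv_oo_cc; rewrite /= in_itv /= => sh Es.
have sDu := smooth_derive u sf.
have psiP t : 0 <= t <= h -> is_derive t 1
    (fun t : R => 'D_u f (x + s *: u + t *: v) : R^o)
    ('D_v ('D_u f) (x + s *: u + t *: v)).
  by move=> th; apply/is_derive_line/(smooth_derivable sDu)/Uh.
have [t] := MVT h0
  (fun t (th : t \in `]0, h[%R) => psiP t (subset_itv_oo_cc th))
  (is_derive_continuous_itv psiP).
move=> /subset_itv_oo_cc; rewrite /= in_itv /= => th Et.
exists s, t; split => //; move: Es Et;
  rewrite /dphi !subr0 !scale0r !addr0 => Es Et.
rewrite -Et [x + s *: u + h *: v]addrAC -Es [x + h *: v + h *: u]addrAC.
by rewrite opprB addrA [LHS]addrAC addrAC.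
Qed.

Lemma near_corner U x u v : nbhs x U ->
  \forall h \near (0 : R)^'+, forall s t, 0 <= s <= h -> 0 <= t <= h ->
    U (x + s *: u + t *: v).
Proof.
move=> /nbhs_ballP[e /= e0 eU].
near=> h => s t /andP[s0 sh] /andP[t0 th]; apply: eU.
rewrite -ball_normE /= -addrA opprD addNKr -normrN opprK.
apply: (le_lt_trans (ler_normD _ _)); rewrite !normrZ !ger0_norm //.
apply: (@le_lt_trans _ _ (h * (`|u| + `|v|))).
  by rewrite mulrDr lerD // ler_wpM2r.
(* The summand 1 keeps the divisor positive when [u] and [v] both vanish. *)
apply: (@le_lt_trans _ _ (h * (`|u| + `|v| + 1))).
  by rewrite ler_wpM2l ?lerDl // (le_trans s0).
rewrite -ltr_pdivlMr ?ltr_wpDl ?addr_ge0 //.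
near: h; apply: nbhs_right_lt; rewrite divr_gt0 // ltr_wpDl ?addr_ge0 //.
Unshelve. all: by end_near. Qed.

(** Exchanging [u] and [v] preserves the second difference, so [g] and [g'] take a common value at
    two, possibly different, points of each small parallelogram; continuity at [x] brings both
    points back to [x]. *)
Lemma mixed_difference_eq U f (g g' : 'rV[R]_n -> R^o) x u v :
  open U -> U x -> {for x, continuous g} -> {for x, continuous g'} ->
  mixed_difference U f g x u v -> mixed_difference U f g' x v u -> g x = g' x.
Proof.
move=> oU Ux cg cg' dg dg'.
apply/eqP; rewrite -subr_eq0 -normr_le0; apply/ler_addgt0Pl => e e0.
have nb (k : 'rV[R]_n -> R^o) : {for x, continuous k} ->
    \forall z \near x, U z /\ `|k x - k z| < e / 2.
  move=> ck; apply: filterI; first exact: open_nbhs_nbhs.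
  by move/cvgrPdist_lt: ck; apply; rewrite divr_gt0.
have [h [h0 [A B]]] := @filter_ex _ _ _ _ (filterI (nbhs_right_gt (0 : R))
  (filterI (near_corner u v (nb _ cg)) (near_corner v u (nb _ cg')))).
have [s [t [sh th E]]] := dg h h0 (fun s t sh th => (A s t sh th).1).
have [s' [t' [sh' th' E']]] := dg' h h0 (fun s t sh th => (B s t sh th).1).
have {E E'} E : g (x + s *: u + t *: v) = g' (x + s' *: v + t' *: u).
  apply: (mulIf (lt0r_neq0 h0)); apply: (mulIf (lt0r_neq0 h0)); rewrite -E -E'.
  by rewrite [x + h *: v + h *: u]addrAC; congr (_ + _); rewrite [LHS]addrAC.
have {A} := (A s t sh th).2; rewrite E => A.
have {B} B := (B s' t' sh' th').2.
rewrite addr0 (splitr e); apply/ltW.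
rewrite -(subrKA (g' (x + s' *: v + t' *: u))).
by apply: (le_lt_trans (ler_normD _ _)); rewrite ltrD // distrC.
Qed.

(* Both mixed derivatives are limits of the same second difference. *)
Lemma schwarz U f x u v : open U -> smooth_on U f -> U x ->
  'D_u ('D_v f) x = 'D_v ('D_u f) x.
Proof.
move=> oU sf Ux.
apply: (@mixed_difference_eq U f ('D_u ('D_v f)) ('D_v ('D_u f)) x v u oU Ux).
- exact: smooth_cont (smooth_derive u (smooth_derive v sf)) Ux.
- exact: smooth_cont (smooth_derive v (smooth_derive u sf)) Ux.
- exact: mixed_difference_derive.
- exact: mixed_difference_derive.
Qed.

End Schwarz.

(** * Coordinates of vector-valued maps *)

Section Components.
Context {R : realType} {n m : nat}.
Implicit Types (U : set 'rV[R]_n) (Z : 'rV[R]_n -> 'rV[R]_m).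

Lemma derive_component U Z v x j : smooth_on U Z -> U x ->
  'D_v (fun z => Z z 0 j : R^o) x = ('D_v Z x) 0 j.
Proof.
by move=> sZ Ux; rewrite derive_mx ?mxE //; exact: smooth_derivable sZ Ux.
Qed.

Lemma smooth_component U Z j : open U -> smooth_on U Z ->
  smooth_on U (fun z => Z z 0 j : R^o).
Proof.
move=> oU sZ.
pose P (f : 'rV[R]_n -> R^o) :=
  exists2 Z : 'rV[R]_n -> 'rV[R]_m, smooth_on U Z & forall z, U z -> f z = Z z 0 j.
suff: forall f, P f -> smooth_on U f by apply; exists Z.
apply: smooth_coind => [f [{}Z {}sZ fE] x Ux|f v [{}Z {}sZ fE]].
- have fE' z : U z -> Z z 0 j = f z by move=> /fE.
  split=> [|v].
    apply: (continuous_eq_on oU fE' Ux).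
    apply: (@continuous_comp _ _ _ Z (fun M : 'rV[R]_m => M 0 j) x (smooth_cont
      sZ Ux)); exact: coord_continuous.
  apply: (derivable_eq_on oU fE' Ux).
  by have /derivable_mxP := smooth_derivable (v := v) sZ Ux; exact.
- exists ('D_v Z); first exact: smooth_derive.
  by move=> x Ux; rewrite (derive_eq_on v oU fE Ux) (derive_component v j sZ
    Ux).
Qed.

End Components.

(** * Complex-valued functions *)

Section ComplexFunctions.
Context {R : realType} {n : nat}.
Implicit Types (U : set 'rV[R]_n) (v x : 'rV[R]_n) (f g : 'rV[R]_n -> R[i]).

Lemma complex_eqP (a b : R[i]) :
  complex.Re a = complex.Re b -> complex.Im a = complex.Im b -> a = b.
Proof. by case: a b => [a1 a2] [b1 b2] /= -> ->. Qed.

Lemma ReM (a b : R[i]) : complex.Re (a * b) =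
  complex.Re a * complex.Re b - complex.Im a * complex.Im b.
Proof. by case: a b => [a1 a2] [b1 b2]. Qed.

Lemma ImM (a b : R[i]) : complex.Im (a * b) =
  complex.Re a * complex.Im b + complex.Im a * complex.Re b.
Proof. by case: a b => [a1 a2] [b1 b2]. Qed.

Lemma ReZ (r : R) (a : R[i]) : complex.Re (r%:C * a) = r * complex.Re a.
Proof. by rewrite ReM mul0r subr0. Qed.

Lemma ReD (a b : R[i]) : complex.Re (a + b) = complex.Re a + complex.Re b.
Proof. by case: a b => [a1 a2] [b1 b2]. Qed.

Lemma ImD (a b : R[i]) : complex.Im (a + b) = complex.Im a + complex.Im b.
Proof. by case: a b => [a1 a2] [b1 b2]. Qed.

Lemma smoothC_sub U U' f : U' `<=` U -> smoothC_on U f -> smoothC_on U' f.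
Proof. by move=> sU [? ?]; split; apply: smooth_sub sU _. Qed.

Lemma smoothC_eq_on U f g : open U -> (forall z, U z -> f z = g z) ->
  smoothC_on U f -> smoothC_on U g.
Proof.
by move=> oU fg [fr fi]; split;
  [apply: smooth_eq_on oU _ fr|apply: smooth_eq_on oU _ fi] => z /fg ->.
Qed.

Lemma smoothC_local U f :
  (forall x, U x -> exists2 U', U' x & smoothC_on U' f) -> smoothC_on U f.
Proof. by move=> lf; split; apply: smooth_local => x /lf[U' U'x [? ?]];
  exists U'. Qed.

Lemma smoothC_cst U (c : R[i]) : smoothC_on U (fun=> c).
Proof. by split; exact: smooth_cst. Qed.

Lemma smoothC_real U (h : 'rV[R]_n -> R^o) : smooth_on U h ->
  smoothC_on U (fun x => (h x)%:C).
Proof. by move=> sh; split; [exact: sh|exact: smooth_cst]. Qed.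

Lemma smoothCD U f g : open U -> smoothC_on U f -> smoothC_on U g ->
  smoothC_on U (fun x => f x + g x).
Proof.
move=> oU [fr fi] [gr gi]; split.
  by under [X in smooth_on _ X]funext do rewrite ReD; exact: smoothD.
by under [X in smooth_on _ X]funext do rewrite ImD; exact: smoothD.
Qed.

Lemma smoothCM U f g : open U -> smoothC_on U f -> smoothC_on U g ->
  smoothC_on U (fun x => f x * g x).
Proof.
move=> oU [fr fi] [gr gi]; split.
  under [X in smooth_on _ X]funext do rewrite ReM.
  exact: smoothB oU (smoothM oU fr gr) (smoothM oU fi gi).
under [X in smooth_on _ X]funext do rewrite ImM.
exact: smoothD oU (smoothM oU fr gi) (smoothM oU fi gr).
Qed.

Lemma smoothCV U f : open U -> (forall x, U x -> f x != 0) -> smoothC_on U f ->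
  smoothC_on U (fun x => (f x)^-1).
Proof.
move=> oU f0 [fr fi].
have n0 x : U x -> complex.Re (f x) ^+ 2 + complex.Im (f x) ^+ 2 != 0.
  move=> /f0; apply: contraNneq => /eqP.
  rewrite paddr_eq0 ?sqr_ge0 // !sqrf_eq0 => /andP[/eqP r0 /eqP i0].
  exact/eqP/complex_eqP.
have sn : smooth_on U
    (fun x => (complex.Re (f x) ^+ 2 + complex.Im (f x) ^+ 2)^-1 : R^o).
  exact: smoothV oU n0 (smoothD oU (smoothM oU fr fr) (smoothM oU fi fi)).
split.
  rewrite (_ : (fun x => _) = fun x => complex.Re (f x) *
    (complex.Re (f x) ^+ 2 + complex.Im (f x) ^+ 2)^-1).
    exact: smoothM oU fr sn.
  by apply/funext => x; case: (f x).
rewrite (_ : (fun x => _) = fun x => - (complex.Im (f x) *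
  (complex.Re (f x) ^+ 2 + complex.Im (f x) ^+ 2)^-1)).
  exact: smoothN oU (smoothM oU fi sn).
by apply/funext => x; case: (f x).
Qed.

Lemma smoothC_deriveC U f v : smoothC_on U f -> smoothC_on U (deriveC f v).
Proof. by move=> [fr fi]; split;
  [exact: smooth_derive fr|exact: smooth_derive fi]. Qed.

Lemma deriveC_eq_on U f g v x : open U -> (forall z, U z -> f z = g z) -> U x ->
  deriveC f v x = deriveC g v x.
Proof.
by move=> oU fg Ux; congr (_ +i* _); apply: derive_eq_on oU _ Ux => z /fg ->.
Qed.

Lemma deriveC_cst (c : R[i]) v x : deriveC (fun=> c) v x = 0.
Proof. by rewrite /deriveC !derive_cst. Qed.

Lemma deriveC_real (h : 'rV[R]_n -> R^o) v x :
  deriveC (fun x => (h x)%:C) v x = ('D_v h x)%:C.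
Proof. by rewrite /deriveC derive_cst. Qed.

Lemma deriveCD U f g v x : smoothC_on U f -> smoothC_on U g -> U x ->
  deriveC (fun z => f z + g z) v x = deriveC f v x + deriveC g v x.
Proof.
move=> [fr fi] [gr gi] Ux; rewrite /deriveC; apply: complex_eqP;
  rewrite ?ReD ?ImD /=.
  under [X in derive X]funext do rewrite ReD.
  exact: (deriveRD (smooth_derivable fr Ux) (smooth_derivable gr Ux)).
under [X in derive X]funext do rewrite ImD.
exact: (deriveRD (smooth_derivable fi Ux) (smooth_derivable gi Ux)).
Qed.

Lemma deriveCM U f g v x : smoothC_on U f -> smoothC_on U g -> U x ->
  deriveC (fun z => f z * g z) v x = deriveC f v x * g x + f x * deriveC g v x.
Proof.
move=> [fr fi] [gr gi] Ux.
have [dfr dfi] := (smooth_derivable (v := v) fr Ux, smooth_derivable (v := v)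
  fi Ux).
have [dgr dgi] := (smooth_derivable (v := v) gr Ux, smooth_derivable (v := v)
  gi Ux).
apply: complex_eqP; rewrite ?ReD ?ImD ?ReM ?ImM /=.
  under [X in derive X]funext do rewrite ReM.
  rewrite (deriveRB (derivableRM dfr dgr) (derivableRM dfi dgi)).
  by rewrite (deriveRM dfr dgr) (deriveRM dfi dgi); ring.
under [X in derive X]funext do rewrite ImM.
rewrite (deriveRD (derivableRM dfr dgi) (derivableRM dfi dgr)).
by rewrite (deriveRM dfr dgi) (deriveRM dfi dgr); ring.
Qed.

Lemma deriveC_schwarz U f u v x : open U -> smoothC_on U f -> U x ->
  deriveC (deriveC f v) u x = deriveC (deriveC f u) v x.
Proof.
by move=> oU [fr fi] Ux;
  rewrite /deriveC /= (schwarz u v oU fr Ux) (schwarz u v oU fi Ux).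
Qed.

End ComplexFunctions.

(** * Line bundles, connections and curvature *)

Lemma addr_idem0 (M : zmodType) (a : M) : a = a + a -> a = 0.
Proof. by rewrite -{1}[a]addr0 => /addrI. Qed.

Lemma addrBB_cancel (M : zmodType) (a b c d : M) :
  a + b - (c + d) - (a - c) = b - d.
Proof. by rewrite [- (c + d)]opprD addrACA [LHS]addrC addKr. Qed.

(** * Local frames and tensorial operators *)

Section Frames.
Context {R : realType} {n : nat} {V : set 'rV[R]_n} (L : line_bundle V).
Implicit Types (U : set 'rV[R]_n) (s t : forall x, L x) (f : 'rV[R]_n -> R[i]).

Lemma base_open : open V.
Proof. by rewrite -(ldom_cover L); apply: bigcup_open => a _;
  exact: ldom_open. Qed.

Lemma base_ldom x : V x -> exists a, ldom L a x.
Proof. by rewrite -{1}(ldom_cover L) => -[a _ ax]; exists a. Qed.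

Lemma ldom_base a : ldom L a `<=` V.
Proof. by move=> x ax; rewrite -(ldom_cover L); exists a. Qed.

(** Chosen fibre by fibre, since the fibres are abstract modules; the value is junk outside of
    [ldom L a]. *)
Definition frame a x : L x := xget 0 [set v | ltriv a x v = 1].

Lemma ltriv_frame a x : ldom L a x -> ltriv a x (frame a x) = 1.
Proof.
move=> ax; have [g _ gK] := ltriv_bij ax.
by apply: (@xgetPex _ 0 [set v | ltriv a x v = 1]); exists (g 1); exact: gK.
Qed.

Lemma ltriv_inj a x : ldom L a x -> injective (ltriv (l := L) a x).
Proof. by move=> ax; have [g gK _] := ltriv_bij ax; exact: can_inj gK. Qed.

Lemma ltrivZ a x (c : R[i]) (v : L x) : ltriv a x (c *: v) = c * ltriv a x v.
Proof. by rewrite linearZ. Qed.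

Lemma ltriv_coord a x (v : L x) : ldom L a x -> v = ltriv a x v *: frame a x.
Proof.
by move=> ax; apply: (ltriv_inj ax); rewrite ltrivZ ltriv_frame // mulr1.
Qed.

Lemma frame_neq0 a x : ldom L a x -> frame a x != 0.
Proof.
move=> ax; apply/eqP => e; have := ltriv_frame ax; rewrite e linear0.
by move/esym/eqP; rewrite oner_eq0.
Qed.

(** Its coordinate in another trivialization is the transition function. *)
Lemma smooth_frame a : smooth_section (ldom L a) (frame a).
Proof.
move=> b; have [u su uE] := ltriv_change (l := L) a b.
apply: smoothC_eq_on su; first by apply: openI; exact: ldom_open.
by move=> x [ax bx]; rewrite uE // ltriv_frame // mulr1.
Qed.

Lemma smooth_section_sub U U' s :
  U' `<=` U -> smooth_section U s -> smooth_section U' s.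
Proof. by move=> sU ss a; apply: smoothC_sub (ss a); exact: setSI. Qed.

Lemma smooth_sectionD U s t :
  open U -> smooth_section U s -> smooth_section U t ->
  smooth_section U (fun x => s x + t x).
Proof.
move=> oU ss st a; under [X in smoothC_on _ X]funext do rewrite linearD.
by apply: smoothCD => //; apply: openI => //; exact: ldom_open.
Qed.

Lemma smooth_sectionZ U f s : open U -> smoothC_on U f -> smooth_section U s ->
  smooth_section U (fun x => f x *: s x).
Proof.
move=> oU sf ss a; under [X in smoothC_on _ X]funext do rewrite ltrivZ.
by apply: smoothCM; [apply: openI => //;
  exact: ldom_open|exact: smoothC_sub sf|].
Qed.

Lemma smooth_section0 U : smooth_section U (fun x => 0 : L x).
Proof.
by move=> a; under [X in smoothC_on _ X]funext do rewrite linear0;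
  exact: smoothC_cst.
Qed.

Lemma smooth_section_sum U (I : Type) (r : seq I) (s : I -> forall x, L x) :
  open U -> (forall i, smooth_section U (s i)) ->
  smooth_section U (fun x => \sum_(i <- r) s i x).
Proof.
move=> oU ss; elim: r => [|i r IH].
  by under [X in smooth_section _ X]functional_extensionality_dep do rewrite
    big_nil; exact: smooth_section0.
under [X in smooth_section _ X]functional_extensionality_dep do rewrite
  big_cons.
exact: smooth_sectionD oU (ss i) IH.
Qed.

(* The value on a frame determines an operator that is linear over functions. *)
Lemma tensorial_scalar x (P : (forall z, L z) -> L x) : V x ->
  (forall U s t, open U -> U `<=` V -> U x -> smooth_section U s ->
    smooth_section U t -> (forall z, U z -> s z = t z) -> P s = P t) ->
  (forall U f s, open U -> U `<=` V -> U x -> smoothC_on U f ->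
    smooth_section U s -> P (fun z => f z *: s z) = f x *: P s) ->
  exists c : R[i], forall U s, open U -> U `<=` V -> U x ->
    smooth_section U s -> P s = c *: s x.
Proof.
move=> Vx Pl Pz; have [a ax] := base_ldom Vx.
exists (ltriv a x (P (frame a))) => U s oU UV Ux ss.
pose W := U `&` ldom L a.
have oW : open W by apply: openI => //; exact: ldom_open.
have Wx : W x by [].
have WV : W `<=` V by move=> z [/UV].
have sf : smoothC_on W (fun z => ltriv a z (s z)) := ss a.
have sW : smooth_section W (frame a) by apply: smooth_section_sub (smooth_frame
  a) => z [].
have sE z : W z -> s z = ltriv a z (s z) *: frame a z by move=> [_ az];
  exact: ltriv_coord.
have ssW : smooth_section W s by apply: smooth_section_sub ss => z [].
(* Locality replaces [s] by its coordinate times the frame on [W], and linearity over functions then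
   takes the coordinate out of [P]. *)
rewrite (Pl W _ _ oW WV Wx ssW (smooth_sectionZ oW sf sW) sE).
rewrite (Pz W _ _ oW WV Wx sf sW) {1}(ltriv_coord (P _) ax) {2}(ltriv_coord (s
  x) ax).
by rewrite !scalerA mulrC.
Qed.

(** A frame does not vanish, so it detects scalars. Identities between values of curvatures or of
    difference forms are proved by letting both sides act on local sections. *)
Lemma tensorial_scalar_uniq x (c c' : R[i]) : V x ->
  (forall U s, open U -> U `<=` V -> U x -> smooth_section U s ->
    c *: s x = c' *: s x) -> c = c'.
Proof.
move=> Vx cc; have [a ax] := base_ldom Vx.
have /(congr1 (ltriv a x)) := cc _ _ (@ldom_open _ _ _ L a) (@ldom_base a) ax
  (@smooth_frame a).
by rewrite !ltrivZ ltriv_frame // !mulr1.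
Qed.

End Frames.

(** * Curvature as a commutator along constant fields *)

Section Curvature.
Context {R : realType} {n : nat} {V : set 'rV[R]_n} {L : line_bundle V}.
Implicit Types (D : connection L) (U : set 'rV[R]_n) (s t : forall x, L x).

Lemma nabla_dir0 D U s x : open U -> U `<=` V -> smooth_section U s -> U x ->
  D 0 s x = 0.
Proof.
move=> oU UV ss Ux; have := nabla_dir D oU UV ss 1 0 0 Ux.
by rewrite scaler0 addr0 scale1r => /addr_idem0.
Qed.

Lemma nabla_dirB D U s x y z :
  open U -> U `<=` V -> smooth_section U s -> U x ->
  D (y - z) s x = D y s x - D z s x.
Proof.
move=> oU UV ss Ux; rewrite [y - z](_ : _ = -1 *: z + y);
  last by rewrite scaleN1r addrC.
by rewrite (nabla_dir D oU UV ss _ _ _ Ux) rmorphN1 scaleN1r addrC.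
Qed.

Lemma nabla_dir_sum D U s x (I : Type) (r : seq I) (c : I -> R)
    (e : I -> 'rV[R]_n) :
  open U -> U `<=` V -> smooth_section U s -> U x ->
  D (\sum_(i <- r) c i *: e i) s x = \sum_(i <- r) (c i)%:C *: D (e i) s x.
Proof.
move=> oU UV ss Ux; elim: r => [|i r IH].
  by rewrite !big_nil (nabla_dir0 D oU UV ss Ux).
by rewrite !big_cons (nabla_dir D oU UV ss _ _ _ Ux) IH.
Qed.

Lemma nabla0 D U x y : open U -> U `<=` V -> U x -> D y (fun=> 0) x = 0.
Proof.
move=> oU UV Ux; have s0 : smooth_section U (fun x => 0 : L x) by exact:
  smooth_section0.
have := nablaD D oU UV s0 s0 y Ux.
rewrite (nabla_local D oU UV (smooth_sectionD oU s0 s0) s0 (fun z _ => addr0 _)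
  y Ux).
by move=> /addr_idem0.
Qed.

Lemma nabla_sum D U x y (I : Type) (r : seq I) (s : I -> forall x, L x) :
  open U -> U `<=` V -> (forall i, smooth_section U (s i)) -> U x ->
  D y (fun z => \sum_(i <- r) s i z) x = \sum_(i <- r) D y (s i) x.
Proof.
move=> oU UV ss Ux; elim: r => [|i r IH].
  rewrite big_nil -(nabla0 D y oU UV Ux);
    apply: (nabla_local D oU UV _ _ _ y Ux).
  - exact: smooth_section_sum.
  - exact: smooth_section0.
  - by move=> z _; rewrite big_nil.
rewrite big_cons -IH -(nablaD D oU UV _ _ y Ux) //;
  last exact: smooth_section_sum.
apply: (nabla_local D oU UV _ _ _ y Ux).
- exact: smooth_section_sum.
- by apply: smooth_sectionD => //; exact: smooth_section_sum.
- by move=> z _; rewrite big_cons.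
Qed.

Lemma nabla_dir_coord D U s x w :
  open U -> U `<=` V -> smooth_section U s -> U x ->
  D w s x = \sum_j (w 0 j)%:C *: D (delta_mx 0 j) s x.
Proof.
by move=> oU UV ss Ux;
  rewrite {1}[w]row_sum_delta (nabla_dir_sum D _ _ _ oU UV ss Ux).
Qed.

(** The axioms of a connection concern constant directions only, so [Z] is expanded in the standard
    basis and the Leibniz rule differentiates its coordinates. *)
Lemma nabla_field D U s x w (Z : 'rV[R]_n -> 'rV[R]_n) :
  open U -> U `<=` V -> smooth_section U s -> U x -> smooth_on U Z ->
  D w (fun z => D (Z z) s z) x = D ('D_w Z x) s x + D w (D (Z x) s) x.
Proof.
move=> oU UV ss Ux sZ.
have sD j : smooth_section U (D (delta_mx 0 j) s) by exact: nabla_smooth.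
have coord (Y : 'rV[R]_n -> 'rV[R]_n) : smooth_on U Y ->
    D w (fun z => D (Y z) s z) x = D ('D_w Y x) s x +
      \sum_j (Y x 0 j)%:C *: D w (D (delta_mx 0 j) s) x.
  move=> sY.
  have sYj j : smoothC_on U (fun z => (Y z 0 j)%:C).
    by apply: smoothC_real; exact: smooth_component.
  have sYD j : smooth_section U (fun z => (Y z 0 j)%:C *: D (delta_mx 0 j) s z).
    exact: smooth_sectionZ oU (sYj j) (sD j).
  have YE z : U z -> \sum_j (Y z 0 j)%:C *: D (delta_mx 0 j) s z = D (Y z) s z.
    by move=> Uz; rewrite (nabla_dir_coord D (Y z) oU UV ss Uz).
  have sS := smooth_section_sum (index_enum _) oU sYD.
  rewrite -(nabla_local D oU UV sS _ YE w Ux).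
    rewrite (nabla_sum D w _ oU UV sYD Ux) (nabla_dir_coord D ('D_w Y x) oU UV
      ss Ux).
    rewrite -big_split; apply: eq_bigr => j _ /=.
    by rewrite (nabla_leibniz D oU UV (sYj j) (sD j) w Ux) deriveC_real
      (derive_component w j sY Ux).
  move=> a; apply: smoothC_eq_on (sS a); first by apply: openI => //;
    exact: ldom_open.
  by move=> z [Uz _]; rewrite YE.
(* The sum in [coord] involves only [Z x]. Applied to the constant field with this value, [coord]
   identifies the sum with the second term. *)
rewrite (coord Z) // (coord (fun=> Z x)); last exact: smooth_cst.
by rewrite derive_cst (nabla_dir0 D oU UV ss Ux) add0r.
Qed.

(** The terms that differentiate [Y] and [Z] are exactly those removed by the bracket, so the
    operator depends only on the values of the fields at [x]. *)
Lemma curvature_opE D U s x (Y Z : 'rV[R]_n -> 'rV[R]_n) :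
  open U -> U `<=` V -> smooth_section U s -> U x ->
  smooth_on U Y -> smooth_on U Z ->
  curvature_op D Y Z s x = D (Y x) (D (Z x) s) x - D (Z x) (D (Y x) s) x.
Proof.
move=> oU UV ss Ux sY sZ;
  rewrite /curvature_op (nabla_field D _ oU UV ss Ux sZ).
rewrite (nabla_field D _ oU UV ss Ux sY) /lie_bracket (nabla_dirB D _ _ oU UV
  ss Ux).
exact: addrBB_cancel.
Qed.

(** The second group is symmetric in [u] and [v], and so is the second derivative of [f]; after
    antisymmetrization only [f x] times the commutator survives. *)
Lemma nabla2Z D U s x u v (f : 'rV[R]_n -> R[i]) :
  open U -> U `<=` V -> smoothC_on U f -> smooth_section U s -> U x ->
  D u (D v (fun z => f z *: s z)) x =
  (deriveC (deriveC f v) u x *: s x + f x *: D u (D v s) x) +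
  (deriveC f v x *: D u s x + deriveC f u x *: D v s x).
Proof.
move=> oU UV sf ss Ux; have sfs := smooth_sectionZ oU sf ss.
have sDv := nabla_smooth D v oU UV ss.
have sf' := smoothC_deriveC v sf.
rewrite (nabla_local D oU UV (nabla_smooth D v oU UV sfs) _
  (fun z Uz => nabla_leibniz D oU UV sf ss v Uz) u Ux); last first.
  exact: smooth_sectionD oU (smooth_sectionZ oU sf' ss) (smooth_sectionZ oU sf
    sDv).
rewrite (nablaD D oU UV (smooth_sectionZ oU sf' ss) (smooth_sectionZ oU sf sDv)
  u Ux).
rewrite (nabla_leibniz D oU UV sf' ss u Ux) (nabla_leibniz D oU UV sf sDv u Ux).
by rewrite [X in _ + X = _]addrC addrACA.
Qed.

(** Tensoriality of the commutator shows that the set from which [curvature] is chosen is inhabited;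
    the chosen scalar is then read off on constant fields. *)
Lemma curvatureP D U s x (v : 'M[R]_(2, n)) :
  open U -> U `<=` V -> smooth_section U s -> U x ->
  D (row 0 v) (D (row 1 v) s) x - D (row 1 v) (D (row 0 v) s) x =
  curvature D x v *: s x.
Proof.
move=> oU UV ss Ux; pose F s : L x :=
  D (row 0 v) (D (row 1 v) s) x - D (row 1 v) (D (row 0 v) s) x.
have [||c cP] := tensorial_scalar (P := F) (UV _ Ux).
- move=> W t t' oW WV Wx st st' tt'; rewrite /F.
  by congr (_ - _); apply: (nabla_local D oW WV) Wx; try exact: nabla_smooth;
    move=> z Wz; exact: (nabla_local D oW WV).
- move=> W f t oW WV Wx sf st; rewrite /F !(nabla2Z D _ _ oW WV sf st Wx).
  rewrite (deriveC_schwarz (row 0 v) (row 1 v) oW sf Wx) opprD addrACA.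
  rewrite [X in _ + (_ - X)]addrC subrr addr0 opprD addrACA subrr add0r.
  by rewrite -scalerBr.
have : exists c, [set c : R[i] |
    forall (U : set 'rV[R]_n) (Y Z : 'rV[R]_n -> 'rV[R]_n) (s : forall x, L x),
    open U -> U `<=` V -> U x ->
    smooth_on U Y -> smooth_on U Z -> smooth_section U s ->
    Y x = row 0 v -> Z x = row 1 v ->
    curvature_op D Y Z s x = c *: s x] c.
  exists c => W Y Z t oW WV Wx sY sZ st Yx Zx.
  by rewrite (curvature_opE D oW WV st Wx sY sZ) Yx Zx; exact: (cP W).
move=> /(xgetPex 0) /(_ U (fun=> row 0 v) (fun=> row 1 v) s oU UV Ux).
move=> /(_ (smooth_cst _) (smooth_cst _) ss erefl erefl).
by rewrite (curvature_opE D oU UV ss Ux (smooth_cst _) (smooth_cst _)).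
Qed.

End Curvature.

(** * Real 1-forms on a chart *)

Section OneForms.
Context {R : realType} {n : nat} {V : set 'rV[R]_n}.
Implicit Types (alpha : rawform R 1 n) (x y z : 'rV[R]_n).

Lemma form1_linear alpha x y z (r : R) : is_form V alpha -> V x ->
  alpha x (r *: y + z) = r * alpha x y + alpha x z.
Proof.
move=> [fa _] Vx; have [ml _] := fa x Vx.
rewrite (ml (r *: y + z) y z 0 r 1) ?mul1r //; last 2 first.
(* Deleting the only row leaves an empty matrix, so the conditions on the other rows are vacuous. *)
- by apply/matrixP => -[].
- by apply/matrixP => -[].
by rewrite scale1r linearP.
Qed.

Lemma linear_form1 alpha : (forall x y z r, V x ->
    alpha x (r *: y + z) = r * alpha x y + alpha x z) ->
  (forall y, smooth_on V (fun x => alpha x y : R^o)) -> is_form V alpha.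
Proof.
move=> la sa; split=> // x Vx; split=> [A B C a b c E _ _|A a b].
  have E' : A = b *: B + c *: C.
    apply/matrixP => i j; move/matrixP: E => /(_ 0 j).
    by rewrite !mxE (ord1 a) (ord1 i).
  have a0 : alpha x 0 = 0.
    by have := la x 0 0 1 Vx; rewrite scaler0 addr0 mul1r => /addr_idem0.
  by rewrite E' la // -[c *: C]addr0 la // a0 addr0.
by rewrite (ord1 a) (ord1 b) eqxx.
Qed.

Lemma smoothC_form1 alpha U (c : R[i]) y :
  is_form V alpha -> open U -> U `<=` V ->
  smoothC_on U (fun x => c * (alpha x y)%:C).
Proof.
move=> [_ sa] oU UV.
exact: (smoothCM oU (smoothC_cst _ c) (smoothC_real (smooth_sub UV (sa y)))).
Qed.

Lemma deriveC_form1 alpha U (c : R[i]) u y x :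
  is_form V alpha -> U `<=` V -> U x ->
  deriveC (fun x => c * (alpha x y)%:C) u x =
  c * ('D_u (fun z => alpha z y : R^o) x)%:C.
Proof.
move=> [_ sa] UV Ux.
rewrite (deriveCM u (smoothC_cst _ c) (smoothC_real (smooth_sub UV (sa y))) Ux).
by rewrite deriveC_cst mul0r add0r deriveC_real.
Qed.

Lemma dform1E alpha x (v : 'M[R]_(2, n)) : dform alpha x v =
  'D_(row 0 v) (fun z => alpha z (row 1 v) : R^o) x -
  'D_(row 1 v) (fun z => alpha z (row 0 v) : R^o) x.
Proof.
have r0 : row' 0 v = row 1 v.
  by apply/matrixP => i j; rewrite !mxE; congr (v _ j); apply/val_inj;
    rewrite (ord1 i).
have r1 : row' 1 v = row 0 v.
  by apply/matrixP => i j; rewrite !mxE; congr (v _ j); apply/val_inj;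
    rewrite (ord1 i).
rewrite /dform big_ord_recl big_ord1 expr0 mul1r.
have -> : lift ord0 ord0 = 1 :> 'I_2 by exact/val_inj.
by rewrite r0 r1 expr1 mulN1r.
Qed.

End OneForms.

(** * Adding a 1-form to a connection *)

Section ShiftedConnections.
Context {R : realType} {n : nat} {V : set 'rV[R]_n} {L : line_bundle V}.
Implicit Types (D : connection L) (U : set 'rV[R]_n) (s t : forall x, L x).
Implicit Types (alpha : rawform R 1 n) (c : R[i]).

(** $D' = D + c\alpha$ as a relation, because connections are total operators specified only on
    smooth local sections. It covers both the connection built by [add_form] and the difference of
    two given ones. *)
Definition shifted D D' c alpha := forall U s, open U -> U `<=` V ->
  smooth_section U s -> forall y x, U x ->
  D' y s x = D y s x + (c * (alpha x y)%:C) *: s x.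

(** Grouped so that the last three terms are jointly symmetric in [u] and [v]; the others give the
    commutator of [D] and $c\,d\alpha$. *)
Lemma shifted_nabla2 D D' c alpha U s u v x : is_form V alpha ->
  shifted D D' c alpha -> open U -> U `<=` V -> smooth_section U s -> U x ->
  D' u (D' v s) x =
  (D u (D v s) x + (c * ('D_u (fun z => alpha z v : R^o) x)%:C) *: s x) +
  ((c * (alpha x u)%:C) *: D v s x + (c * (alpha x v)%:C) *: D u s x +
   (c * (alpha x v)%:C * (c * (alpha x u)%:C)) *: s x).
Proof.
move=> fa DD' oU UV ss Ux.
have sb := smoothC_form1 c v fa oU UV.
have sbs := smooth_sectionZ oU sb ss.
have sDv := nabla_smooth D v oU UV ss.
rewrite (nabla_local D' oU UV (nabla_smooth D' v oU UV ss)
  (smooth_sectionD oU sDv sbs) (fun z Uz => DD' U s oU UV ss v z Uz) u Ux).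
rewrite (nablaD D' oU UV sDv sbs u Ux) (nabla_leibniz D' oU UV sb ss u Ux).
rewrite (DD' U _ oU UV sDv u x Ux) (DD' U s oU UV ss u x Ux).
rewrite (deriveC_form1 c u v fa UV Ux) scalerDr scalerA.
by rewrite addrACA; congr (_ + _); rewrite addrA.
Qed.

Lemma curvature_shifted D D' c alpha x v : is_form V alpha ->
  shifted D D' c alpha -> V x ->
  curvature D' x v = curvature D x v + c * (dform alpha x v)%:C.
Proof.
move=> fa DD' Vx; apply: (tensorial_scalar_uniq (L := L) Vx) => U s oU UV Ux ss.
rewrite -(curvatureP D' v oU UV ss Ux) scalerDl -(curvatureP D v oU UV ss Ux).
rewrite !(shifted_nabla2 _ _ fa DD' oU UV ss Ux) dform1E rmorphB mulrBr
  scalerBl.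
(* After two exchanges both iterated derivatives end with the same group [X]. The second one is
   where commutativity of scalars kills the quadratic term. *)
rewrite [(c * (alpha x (row 1 v))%:C) *: D (row 0 v) s x + _]addrC.
rewrite (mulrC (c * (alpha x (row 0 v))%:C)).
set X := (_ *: _ + _) + _; set a := _ *: s x; set b := _ *: s x.
by rewrite [- (_ + X)]opprD addrACA subrr addr0 opprD addrACA.
Qed.

Definition add_form D c alpha (fa : is_form V alpha) : connection L.
Proof.
refine (@Connection _ _ _ L
  (fun y s x => D y s x + (c * (alpha x y)%:C) *: s x) _ _ _ _ _).
- move=> U s t oU UV ss st st_eq y x Ux.
  by rewrite (nabla_local D oU UV ss st st_eq y Ux) st_eq.
- move=> U s y oU UV ss; apply: (smooth_sectionD oU (nabla_smooth D y oU UV ss)).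
  exact: smooth_sectionZ oU (smoothC_form1 c y fa oU UV) ss.
- move=> U s oU UV ss r y z x Ux.
  rewrite (nabla_dir D oU UV ss r y z Ux) (form1_linear y z r fa (UV _ Ux)).
  rewrite rmorphD rmorphM mulrDr mulrCA scalerDl scalerDr.
  rewrite -[(r%:C * _) *: s x]scalerA.
  exact: addrACA.
- move=> U s t oU UV ss st y x Ux.
  by rewrite (nablaD D oU UV ss st y Ux) scalerDr addrACA.
- move=> U f s oU UV sf ss y x Ux.
  rewrite (nabla_leibniz D oU UV sf ss y Ux) scalerDr -addrA;
    congr (_ + (_ + _)).
  by rewrite !scalerA mulrC.
Defined.

Lemma shifted_add_form D c alpha (fa : is_form V alpha) :
  shifted D (add_form D c fa) c alpha.
Proof. by []. Qed.

(** * Hermitian metrics and unitary connections *)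

Section Hermitian.
Variable h : hermitian_metric L.

Lemma hdotZl x a (v w : L x) : V x -> h x (a *: v) w = a * h x v w.
Proof.
move=> Vx; have h0 : h x 0 w = 0.
  by have := hdot_linear h Vx w 1 0 0;
    rewrite scaler0 addr0 mul1r => /addr_idem0.
by have := hdot_linear h Vx w a v 0; rewrite !addr0 h0 addr0.
Qed.

Lemma hdotDl x (u v w : L x) : V x -> h x (u + v) w = h x u w + h x v w.
Proof. by move=> Vx; have := hdot_linear h Vx w 1 u v;
  rewrite scale1r mul1r. Qed.

Lemma hdotZr x a (v w : L x) : V x -> h x v (a *: w) = a^*%C * h x v w.
Proof.
move=> Vx; rewrite (hdot_sym h Vx v w) (hdot_sym h Vx v (a *: w)) hdotZl //.
exact: rmorphM.
Qed.

Lemma hdotDr x (u v w : L x) : V x -> h x u (v + w) = h x u v + h x u w.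
Proof.
move=> Vx; rewrite (hdot_sym h Vx u v) (hdot_sym h Vx u w)
  (hdot_sym h Vx u (v + w)).
by rewrite hdotDl //; exact: rmorphD.
Qed.

Lemma hdotNl x (v w : L x) : V x -> h x (- v) w = - h x v w.
Proof. by move=> Vx; rewrite -scaleN1r hdotZl // mulN1r. Qed.

Lemma hdotNr x (v w : L x) : V x -> h x v (- w) = - h x v w.
Proof. by move=> Vx; rewrite -scaleN1r hdotZr // rmorphN1 mulN1r. Qed.

Lemma hdot_frame_neq0 a x : ldom L a x -> h x (frame a x) (frame a x) != 0.
Proof.
by move=> ax; rewrite lt0r_neq0 // hdot_gt0 ?frame_neq0 //; exact: ldom_base ax.
Qed.

(** On a frame $e$ the hypothesis reads $(c+\bar c)\,h(e,e)=0$ with $h(e,e) \neq 0$. It serves for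
    curvatures and for differences of unitary connections alike. *)
Lemma skew_scalar x (c : R[i]) : V x ->
  (forall U s, open U -> U `<=` V -> U x -> smooth_section U s ->
    h x (c *: s x) (s x) + h x (s x) (c *: s x) = 0) -> c^*%C = - c.
Proof.
move=> Vx hc; have [a ax] := base_ldom L Vx.
have /eqP := hc _ _ (@ldom_open _ _ _ L a) (@ldom_base _ _ _ L a) ax
  (@smooth_frame _ _ _ L a).
rewrite hdotZl // hdotZr // -mulrDl mulf_eq0 (negPf (hdot_frame_neq0 ax)) orbF.
by rewrite addrC addr_eq0 => /eqP.
Qed.

Lemma unitary_add_form D c alpha (fa : is_form V alpha) : c^*%C = - c ->
  unitary h D -> unitary h (add_form D c fa).
Proof.
move=> cc uD U s t oU UV ss st y x Ux; have Vx := UV _ Ux.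
rewrite (uD U s t oU UV ss st y x Ux) /= hdotDl // hdotDr // hdotZl //
  hdotZr //.
have -> : (c * (alpha x y)%:C)^*%C = - (c * (alpha x y)%:C).
  transitivity (c^*%C * ((alpha x y)%:C)^*%C); first exact: rmorphM.
  by rewrite cc conjc_real mulNr.
by rewrite mulNr addrACA addrN addr0.
Qed.

Lemma unitary2 D U s t u v x : unitary h D -> open U -> U `<=` V ->
  smooth_section U s -> smooth_section U t -> U x ->
  deriveC (deriveC (fun z => h z (s z) (t z)) v) u x =
  (h x (D u (D v s) x) (t x) + h x (s x) (D u (D v t) x)) +
  (h x (D v s x) (D u t x) + h x (D u s x) (D v t x)).
Proof.
move=> uD oU UV ss st Ux.
have sDs := nabla_smooth D v oU UV ss; have sDt := nabla_smooth D v oU UV st.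
rewrite (deriveC_eq_on u oU (fun z Uz => uD U s t oU UV ss st v z Uz) Ux).
rewrite (deriveCD u (hdot_smooth h oU UV sDs st) (hdot_smooth h oU UV ss sDt)
  Ux).
rewrite (uD U _ _ oU UV sDs st u x Ux) (uD U _ _ oU UV ss sDt u x Ux).
by rewrite [X in _ + X = _]addrC addrACA.
Qed.

(** The second derivatives of $h(s,s)$ commute, and the mixed terms of [unitary2] are symmetric in
    the two directions; what remains says that the commutator is skew for [h]. *)
Lemma curvature_imaginary D x v : unitary h D -> V x ->
  (curvature D x v)^*%C = - curvature D x v.
Proof.
move=> uD Vx; apply: (skew_scalar Vx) => U s oU UV Ux ss.
rewrite -(curvatureP D v oU UV ss Ux) hdotDl // hdotDr // hdotNl // hdotNr //
  addrACA -opprD.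
have := deriveC_schwarz (row 0 v) (row 1 v) oU (hdot_smooth h oU UV ss ss) Ux.
rewrite !(unitary2 _ _ uD oU UV ss ss Ux).
rewrite [X in _ + X = _]addrC => /addIr ->.
by rewrite subrr.
Qed.

End Hermitian.

(** * The difference of two connections *)

Section Difference.
Variables D D' : connection L.

(** The 1-form $D'-D$. Asking for one scalar valid for all local sections avoids choosing a
    trivialization; [conn_diffP] shows that the default is never reached over [V]. *)
Definition conn_diff x y : R[i] := xget 0 [set c | forall U s,
  open U -> U `<=` V -> U x -> smooth_section U s ->
  D' y s x - D y s x = c *: s x].

Lemma conn_diffP U s x y : open U -> U `<=` V -> U x -> smooth_section U s ->
  D' y s x - D y s x = conn_diff x y *: s x.
Proof.
move=> oU UV Ux ss.
suff /(xgetPex 0) cP : exists c, [set c : R[i] | forall U s,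
    open U -> U `<=` V -> U x -> smooth_section U s ->
    D' y s x - D y s x = c *: s x] c.
  exact: (cP U s oU UV Ux ss).
apply: (tensorial_scalar (P := fun s => D' y s x - D y s x) (UV _ Ux)).
- move=> W s1 s2 oW WV Wx ss1 ss2 s12.
  by rewrite (nabla_local D oW WV ss1 ss2 s12 y Wx) (nabla_local D' oW WV ss1
    ss2 s12 y Wx).
- move=> W f s1 oW WV Wx sf ss1.
  rewrite (nabla_leibniz D oW WV sf ss1 y Wx) (nabla_leibniz D' oW WV sf ss1 y
    Wx).
  by rewrite opprD addrACA subrr add0r scalerBr.
Qed.

Lemma conn_diff_uniq x y c : V x -> (forall U s, open U -> U `<=` V -> U x ->
    smooth_section U s -> D' y s x - D y s x = c *: s x) -> conn_diff x y = c.
Proof.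
move=> Vx cP; apply: (tensorial_scalar_uniq (L := L) Vx) => U s oU UV Ux ss.
by rewrite -(conn_diffP y oU UV Ux ss) (cP U).
Qed.

Lemma conn_diff_linear x y z (r : R) : V x ->
  conn_diff x (r *: y + z) = r%:C * conn_diff x y + conn_diff x z.
Proof.
move=> Vx; apply: (conn_diff_uniq Vx) => U s oU UV Ux ss.
rewrite (nabla_dir D oU UV ss r y z Ux) (nabla_dir D' oU UV ss r y z Ux).
rewrite opprD addrACA -scalerBr (conn_diffP y oU UV Ux ss) (conn_diffP z oU UV
  Ux ss).
by rewrite scalerA scalerDl.
Qed.

(** Over a trivializing open set it is the coordinate of the smooth section $D'_y e - D_y e$, with
    $e$ the frame. *)
Lemma conn_diff_smooth y : smoothC_on V (conn_diff^~ y).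
Proof.
apply: smoothC_local => x /(base_ldom L)[a ax]; exists (ldom L a);
  first exact: ax.
have [[oa aV] sa] := (@ldom_open _ _ _ L a, @ldom_base _ _ _ L a, @smooth_frame
  _ _ _ L a).
have sD := nabla_smooth D y oa aV sa; have sD' := nabla_smooth D' y oa aV sa.
have sN := smooth_sectionZ oa (smoothC_cst _ (-1)) sD.
have := smooth_sectionD oa sD' sN a; rewrite setIid => sd.
apply: (smoothC_eq_on oa _ sd) => z az.
by rewrite scaleN1r (conn_diffP y oa aV az sa) ltrivZ ltriv_frame // mulr1.
Qed.

Lemma conn_diff_imaginary (h : hermitian_metric L) x y :
  unitary h D -> unitary h D' -> V x ->
  (conn_diff x y)^*%C = - conn_diff x y.
Proof.
move=> uD uD' Vx; apply: (skew_scalar (h := h) Vx) => U s oU UV Ux ss.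
rewrite -(conn_diffP y oU UV Ux ss) hdotDl // hdotDr // hdotNl // hdotNr //
  addrACA -opprD.
by rewrite -(uD U s s oU UV ss ss y x Ux) -(uD' U s s oU UV ss ss y x Ux) subrr.
Qed.

End Difference.

End ShiftedConnections.

(** * Orbifold connections and Chern forms *)

Section Intertwining.
Context {R : realType} {m n : nat} {V : set 'rV[R]_m} {V' : set 'rV[R]_n}.
Context {L : line_bundle V} {L' : line_bundle V'} {f : 'rV[R]_m -> 'rV[R]_n}.
Variable phi : forall x, L x -> L' (f x).
Hypothesis phi_iso : bundle_iso phi.

Lemma bundle_isoD x (u v : L x) : V x -> phi (u + v) = phi u + phi v.
Proof. by move=> Vx; have := (phi_iso.1 x Vx).1 1 u v; rewrite !scale1r. Qed.

Lemma bundle_isoZ x (a : R[i]) (v : L x) : V x -> phi (a *: v) = a *: phi v.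
Proof.
move=> Vx; have phi0 : phi (0 : L x) = 0.
  by have := bundle_isoD 0 0 Vx; rewrite addr0 => /addr_idem0.
by have := (phi_iso.1 x Vx).1 a v 0; rewrite !addr0 phi0 addr0.
Qed.

Lemma bundle_isoB x (u v : L x) : V x -> phi (u - v) = phi u - phi v.
Proof. by move=> Vx; rewrite bundle_isoD // -[- v]scaleN1r bundle_isoZ //
  scaleN1r. Qed.

Lemma open_preimage_on (O : set 'rV[R]_n) : smooth_on V f -> open V -> open O ->
  open (V `&` f @^-1` O).
Proof.
move=> sf oV oO; rewrite openE => x [Vx Ofx]; apply: filterI.
  exact: open_nbhs_nbhs.
by apply: (smooth_cont sf Vx); exact: open_nbhs_nbhs.
Qed.

(** [intertwines] speaks of pairs of sections matched by [phi]. Pulling a frame of [L'] back only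
    inverts [phi] on fibres, whereas pushing a section forward would require inverting [f]. *)
Definition transported_frame b x : L x :=
  xget 0 [set v : L x | phi v = frame b (f x)].

Lemma transported_frameP b x : V x ->
  phi (transported_frame b x) = frame b (f x).
Proof.
move=> Vx; have [g _ gK] := (phi_iso.1 x Vx).2.
apply: (@xgetPex _ 0 [set v : L x | phi v = frame b (f x)]).
by exists (g (frame b (f x))); exact: gK.
Qed.

(** Its coordinate is the inverse of the function [u] that represents [phi] in the two
    trivializations. *)
Lemma smooth_transported_frame b : smooth_on V f ->
  smooth_section (V `&` f @^-1` ldom L' b) (transported_frame b).
Proof.
move=> sf a; have [u su uE] := phi_iso.2 a b.
have oV := base_open L.
have oW : open ((V `&` f @^-1` ldom L' b) `&` ldom L a).
  apply: openI; last exact: ldom_open.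
  by apply: (open_preimage_on sf oV); exact: ldom_open.
have uK z : ((V `&` f @^-1` ldom L' b) `&` ldom L a) z ->
    u z * ltriv a z (transported_frame b z) = 1.
  by move=> [[Vz bz] az]; rewrite -uE // transported_frameP // ltriv_frame.
have u0 z : ((V `&` f @^-1` ldom L' b) `&` ldom L a) z -> u z != 0.
  by move=> /uK; apply: contra_eq_neq => ->; rewrite mul0r eq_sym oner_eq0.
have sV := smoothCV oW u0 (smoothC_sub _ su).
apply: (smoothC_eq_on oW _ (sV _)); last by move=> z [[]].
move=> z Wz; apply: (mulfI (u0 _ Wz)); rewrite uK // mulfV //; exact: u0.
Qed.

(** Invariance of the difference form under pullback: both pairs of connections are tested on a
    frame and its transport, and [phi] carries one difference to the other. *)
Lemma conn_diff_intertwines (D1 D2 : connection L) (D1' D2' : connection L')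
    x y :
  smooth_on V f -> intertwines phi D1 D1' -> intertwines phi D2 D2' ->
  V x -> V' (f x) ->
  conn_diff D1' D2' (f x) ('D_y f x) = conn_diff D1 D2 x y.
Proof.
move=> sf i1 i2 Vx /(base_ldom L')[b bx].
pose U := V `&` f @^-1` ldom L' b.
have ob := @ldom_open _ _ _ L' b; have oV := base_open L.
have oU : open U by exact: open_preimage_on.
have UV : U `<=` V by move=> z [].
have bV := @ldom_base _ _ _ L' b.
have fU : f @` U `<=` ldom L' b by move=> _ [z [_ bz] <-].
have ss := smooth_transported_frame b sf.
have ss' := @smooth_frame _ _ _ L' b.
have Ux : U x by [].
have sE z : U z -> phi (transported_frame b z) = frame b (f z).
  by move=> [Vz _]; exact: transported_frameP.
have e1 := i1 _ _ _ _ oU UV ob bV fU ss ss' sE y x Ux.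
have e2 := i2 _ _ _ _ oU UV ob bV fU ss ss' sE y x Ux.
(* Writing 1 as the coordinate of the frame turns the equality of scalars into one of vectors. *)
apply: (mulIf (oner_neq0 R[i])); rewrite -(ltriv_frame bx) -!ltrivZ.
rewrite -(conn_diffP D1' D2' _ ob bV bx ss') -e1 -e2 -(sE _ Ux) -bundle_isoZ //.
by rewrite -(conn_diffP D1 D2 y oU UV Ux ss) bundle_isoB //.
Qed.

Lemma intertwines_add_form (D : connection L) (D' : connection L')
    (c : R[i]) (alpha : rawform R 1 m) (alpha' : rawform R 1 n)
    (fa : is_form V alpha) (fa' : is_form V' alpha') :
  (forall x y, V x -> alpha' (f x) ('D_y f x) = alpha x y) ->
  intertwines phi D D' -> intertwines phi (add_form D c fa) (add_form D' c fa').
Proof.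
move=> aE iD U U' s s' oU UV oU' UV' fU ss ss' sE y x Ux; have Vx := UV _ Ux.
by rewrite /= bundle_isoD // bundle_isoZ // (iD U U' s s') // sE // aE.
Qed.

End Intertwining.

(** * The normalizing factor *)

Section ChernScalar.
Context {R : realType}.

(** The factor of [chern_form]; its inverse $-2\pi i$ is the constant by which real forms are added
    to connections. *)
Definition chern_scalar : R[i] := 'i%C / (2 * pi)%:C.

Lemma pi2_neq0 : 2 * pi != 0 :> R.
Proof. by rewrite mulf_neq0 ?pnatr_eq0 // lt0r_neq0 // pi_gt0. Qed.

Lemma chern_scalarE : chern_scalar = ((2 * pi)^-1)%:C * 'i%C.
Proof. by rewrite /chern_scalar fmorphV mulrC. Qed.

Lemma chern_scalar_neq0 : chern_scalar != 0.
Proof.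
rewrite chern_scalarE mulf_neq0 //.
  by rewrite fmorph_eq0 invr_eq0 pi2_neq0.
by rewrite eq_complex /= oner_eq0 andbF.
Qed.

Lemma chern_scalar_conj : chern_scalar^*%C = - chern_scalar.
Proof. by rewrite chern_scalarE; apply: complex_eqP => /=; ring. Qed.

Lemma chern_scalarV_conj : (chern_scalar^-1)^*%C = - chern_scalar^-1.
Proof. by rewrite conjc_inv chern_scalar_conj invrN. Qed.

Lemma Re_imaginaryM (a b : R[i]) : a^*%C = - a -> b^*%C = - b ->
  (complex.Re (a * b))%:C = a * b.
Proof.
have imaginary (z : R[i]) : z^*%C = - z -> complex.Re z = 0.
  by case: z => x y [/eqP]; rewrite -addr_eq0 -mulr2n mulrn_eq0 /= => /eqP.
move=> /imaginary a0 /imaginary b0; apply: complex_eqP => //.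
by rewrite ImM a0 b0 mul0r mulr0 addr0.
Qed.

(** This undoes the real parts taken in [chern_form] and in [odiff]. *)
Lemma Re_chern_scalar (a : R[i]) : a^*%C = - a ->
  (complex.Re (chern_scalar * a))%:C = chern_scalar * a.
Proof. exact/Re_imaginaryM/chern_scalar_conj. Qed.

Lemma chern_scalar_hbar (hbar : R) :
  chern_scalar * (- ('i%C / hbar%:C)) = ((2 * pi * hbar)^-1)%:C.
Proof.
rewrite chern_scalarE -fmorphV; apply: complex_eqP => /=; last by ring.
by rewrite !invfM; ring.
Qed.

End ChernScalar.

(** * Combinations of orbifold forms and their classes *)

Section FormCombination.
Context {R : realType} {X : orbifold R} {k : nat}.

Lemma is_form_comb n (V : set 'rV[R]_n) (a : R) (eta theta : rawform R k n) :
  open V -> is_form V eta -> is_form V theta ->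
  is_form V (fun x v => a * eta x v + theta x v).
Proof.
move=> oV [ae se] [at' st]; split=> [x Vx|v]; last first.
  exact: smoothD oV (smoothM oV (smooth_cst (a : R^o)) (se v)) (st v).
have [[le ale] [lt alt]] := (ae x Vx, at' x Vx).
split=> [A B C i b c E1 E2 E3|A i j ij E1].
  by rewrite (le A B C i b c E1 E2 E3) (lt A B C i b c E1 E2 E3); ring.
by rewrite (ale A i j ij E1) (alt A i j ij E1) mulr0 addr0.
Qed.

Lemma dform_comb n (V : set 'rV[R]_n) (a : R) (eta theta : rawform R k n) x v :
  is_form V eta -> is_form V theta -> V x ->
  dform (fun x v => a * eta x v + theta x v) x v =
    a * dform eta x v + dform theta x v.
Proof.
move=> [_ se] [_ st] Vx; rewrite /dform mulr_sumr -big_split;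
  apply: eq_bigr => i _ /=.
have de := smooth_derivable (v := row i v) (se (row' i v)) Vx.
have dt := smooth_derivable (v := row i v) (st (row' i v)) Vx.
have dc : derivable (fun=> a : R^o) x (row i v) by exact: derivable_cst.
rewrite (deriveRD (derivableRM dc de) dt) (deriveRM dc de) derive_cst.
by ring.
Qed.

(** One operation provides sums, differences and, together with [oform0], multiples. *)
Definition oform_comb (a : R) (eta theta : oform X k) : oform X k.
Proof.
refine (@OForm R X k (fun i x v => a * eta i x v + theta i x v) _ _ _).
- by move=> i; apply: is_form_comb;
  [exact: cdom_open|exact: ofam_form|exact: ofam_form].
- move=> i g x v dx; congr (_ * _ + _); exact: ofam_invariant.
- move=> i j e x v dx; congr (_ * _ + _); exact: ofam_compatible.
Defined.

Definition oform0 : oform X k.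
Proof.
refine (@OForm R X k (fun i x v => 0) _ _ _) => // i; split=> [x _|v].
  by split=> // A B C a b c _ _ _; rewrite !mulr0 addr0.
exact: smooth_cst.
Defined.

Lemma dform_oform0 i x v : dform (oform0 i) x v = 0.
Proof. by rewrite /dform big1 // => a _; rewrite derive_cst mulr0. Qed.

Lemma dform_oform_comb (a : R) (eta theta : oform X k) i x v : odom i x ->
  dform (oform_comb a eta theta i) x v =
    a * dform (eta i) x v + dform (theta i) x v.
Proof. exact: dform_comb (ofam_form eta i) (ofam_form theta i). Qed.

End FormCombination.

Section Cohomology.
Context {R : realType} {X : orbifold R}.

(** Representatives are mere families on the charts, so the classes are compared as sets: the
    primitive of a member is shifted by plus or minus [alpha]. *)
Lemma dR_class_exact k (eta eta' : forall i : oidx X, rawform R k.+1 (odim i))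
    (alpha : oform X k) :
  (forall i x v, odom i x -> eta' i x v = eta i x v + dform (alpha i) x v) ->
  dR_class eta' = dR_class eta.
Proof.
move=> etaE; apply/seteqP; split=> theta [ctheta [beta betaE]]; split=> //.
  exists (oform_comb 1 alpha beta) => i x v dx.
  by rewrite betaE // etaE // dform_oform_comb // mul1r addrA.
exists (oform_comb (-1) alpha beta) => i x v dx.
by rewrite betaE // etaE // dform_oform_comb //; ring.
Qed.

Lemma dR_class_scale k (a : R) (omega : oform X k.+1) : oclosed omega ->
  dR_class (fun i x v => a * omega i x v) (oform_comb a omega oform0).
Proof.
move=> cw; split=> [i x v dx|].
  by rewrite dform_oform_comb // cw // dform_oform0 mulr0 addr0.
by exists oform0 => i x v dx; rewrite dform_oform0.
Qed.

End Cohomology.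

Lemma pullback1 (R : realType) m n (f : 'rV[R]_m -> 'rV[R]_n)
    (eta : rawform R 1 n) x v :
  pullback f eta x v = eta (f x) ('D_v f x).
Proof.
rewrite /pullback; congr (eta _ _); apply/matrixP => i j; rewrite mxE.
have -> : row i v = v by apply/matrixP => i' j'; rewrite mxE (ord1 i) (ord1 i').
by rewrite (ord1 i).
Qed.

Lemma emap_dom (R : realType) (X : orbifold R) (i j : oidx X)
  (e : chart_embedding (ochart i) (ochart j)) x : odom i x -> odom j (e x).
Proof. by move=> dx; have [_ sub _ _] := emap_embedding e; apply: sub;
  exists x. Qed.

Lemma emap_smooth (R : realType) (X : orbifold R) (i j : oidx X)
  (e : chart_embedding (ochart i) (ochart j)) : smooth_on (odom i) e.
Proof. by have [] := emap_embedding e. Qed.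

(** * Unitary orbifold connections and the Chern class *)

Section OrbifoldConnections.
Context {R : realType} {X : orbifold R} {L : herm_orbi_line_bundle X}.

Section Difference.
Variables D D' : orbi_connection L.

Lemma odiff_form i : is_form (odom i)
  (fun x v => complex.Re (chern_scalar * conn_diff (D i) (D' i) x v)).
Proof.
apply: linear_form1 => [x y z r dx|y].
  by rewrite conn_diff_linear // mulrDr ReD mulrCA ReZ.
have oV : open (odom i) by exact: cdom_open.
exact: (smoothCM oV (smoothC_cst _ chern_scalar) (conn_diff_smooth (D i) (D' i)
  y)).1.
Qed.

(** The real part makes this an orbifold form for any two orbifold connections; for unitary ones it
    loses nothing, by [conn_diff_imaginary]. *)
Definition odiff : oform X 1.
Proof.
refine (OForm odiff_form _ _).
- move=> i g x v dx; rewrite pullback1; congr (complex.Re (_ * _)).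
  apply: (conn_diff_intertwines (oact_iso L g)) => //.
  + exact: cact_smooth.
  + exact: oconn_equivariant.
  + exact: oconn_equivariant.
  + exact: cact_dom.
- move=> i j e x v dx; rewrite pullback1; congr (complex.Re (_ * _)).
  apply: (conn_diff_intertwines (oglue_iso L e)) => //.
  + exact: emap_smooth.
  + exact: oconn_compatible.
  + exact: oconn_compatible.
  + exact: emap_dom.
Defined.

Lemma shifted_odiff i : ounitary D -> ounitary D' ->
  shifted (D i) (D' i) chern_scalar^-1 (odiff i).
Proof.
move=> uD uD' U s oU UV ss y x Ux /=.
rewrite Re_chern_scalar;
  last exact: conn_diff_imaginary (uD i) (uD' i) (UV _ Ux).
rewrite mulKf ?chern_scalar_neq0 // -(conn_diffP (D i) (D' i) y oU UV Ux ss).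
by rewrite addrC subrK.
Qed.

Lemma chern_form_odiff i x v : ounitary D -> ounitary D' -> odom i x ->
  chern_form D' x v = chern_form D x v + dform (odiff i) x v.
Proof.
move=> uD uD' dx; rewrite /chern_form -/chern_scalar.
rewrite (curvature_shifted v (ofam_form odiff i) (shifted_odiff uD uD') dx).
by rewrite mulrDr mulVKf ?chern_scalar_neq0 // ReD.
Qed.

End Difference.

Section Addition.
Variables (D : orbi_connection L) (c : R[i]) (alpha : oform X 1).

Definition oadd_form : orbi_connection L.
Proof.
refine (@OrbiConnection _ _ _
  (fun i => add_form (D i) c (ofam_form alpha i)) _ _).
- move=> i g; apply: (intertwines_add_form (oact_iso L g)).
    by move=> x y dx; rewrite -pullback1; exact: ofam_invariant.
  exact: oconn_equivariant.
- move=> i j e; apply: (intertwines_add_form (oglue_iso L e)).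
    by move=> x y dx; rewrite -pullback1; exact: ofam_compatible.
  exact: oconn_compatible.
Defined.

Lemma ounitary_oadd_form : c^*%C = - c -> ounitary D -> ounitary oadd_form.
Proof. by move=> cc uD i; exact: unitary_add_form. Qed.

Lemma curvature_oadd_form i x v : odom i x ->
  curvature (oadd_form i) x v =
    curvature (D i) x v + c * (dform (alpha i) x v)%:C.
Proof.
move=> dx; apply: (curvature_shifted v (ofam_form alpha i) _ dx).
exact: shifted_add_form.
Qed.

End Addition.

(** The choice made in [c1dR] returns some unitary connection, not a prescribed one;
    [chern_form_odiff] is what relates it to another. *)
Lemma c1dRP : (exists D : orbi_connection L, ounitary D) ->
  exists2 D : orbi_connection L, ounitary D & c1dR L = dR_class (chern_form D).
Proof.
move=> [D uD].
apply: (@xgetPex _ set0 [set c | exists2 D : orbi_connection L, ounitary D &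
  c = dR_class (chern_form D)]).
by exists (dR_class (chern_form D)); exists D.
Qed.

Lemma c1dR_unitary (c : oform X 2) :
  c1dR L c -> exists D : orbi_connection L, ounitary D.
Proof.
apply: contraPP => nD; rewrite /c1dR xgetPN // => _ [D uD _].
by apply: nD; exists D.
Qed.

End OrbifoldConnections.

Theorem theorem5p10 (R : realType) (X : orbifold R) (omega : oform X 2)
    (omega_symplectic : symplectic omega) (hbar : R) (hbar_gt0 : 0 < hbar)
    (L : herm_orbi_line_bundle X) :
  (exists2 D : orbi_connection L, ounitary D &
     forall (i : oidx X) (x : 'rV[R]_(odim i)) (v : 'M[R]_(2, odim i)),
       odom i x ->
       curvature (D i) x v = - ('i%C / hbar%:C) * (omega i x v)%:C)
  <->
  c1dR L = dR_class (fun i x v => (2 * pi * hbar)^-1 * omega i x v).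
Proof.
split=> [[D uD FD]|c1E].
  have [D' uD' ->] : exists2 D : orbi_connection L, ounitary D &
    c1dR L = dR_class (chern_form D) by apply: c1dRP; exists D.
  apply: (@dR_class_exact _ _ _ _ _ (odiff D D')) => i x v dx.
  rewrite (chern_form_odiff v uD uD' dx); congr (_ + _).
  by rewrite /chern_form FD // -/chern_scalar mulrA chern_scalar_hbar -rmorphM.
have := dR_class_scale (2 * pi * hbar)^-1 omega_symplectic.1.
(* Membership of the rescaled [omega] is used twice: it forces a unitary connection to exist, then
   supplies the primitive [alpha] relative to the chosen [D]. *)
rewrite -c1E => c1w; have [D uD DE] := c1dRP (c1dR_unitary c1w).
move: c1w; rewrite DE => -[_ [alpha alphaE]].
exists (oadd_form D chern_scalar^-1 alpha).
  exact: ounitary_oadd_form chern_scalarV_conj uD.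
move=> i x v dx; rewrite curvature_oadd_form //.
(* Multiplication by $i/2\pi$ turns the curvature equation into the equation [alphaE] between real
   forms. *)
apply: (mulfI (@chern_scalar_neq0 R)).
rewrite mulrDr mulVKf ?chern_scalar_neq0 // [RHS]mulrA chern_scalar_hbar
  -rmorphM.
have /= := alphaE i x v dx; rewrite addr0 => ->.
rewrite rmorphD; congr (_ + _); apply/esym/Re_chern_scalar.
exact: curvature_imaginary (uD i) dx.
Qed.
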